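(* For every integer $k\geq 2$ there exist a constant $C>0$ and a family $(Y_n)_{n\in\mathbb N}$ of pure $k$-dimensional simplicial complexes, where $Y_n$ has $n$ vertices and complete $(k-1)$-skeleton, such that: (1) all nontrivial eigenvalues of $\Delta^{\mathrm{up}}_{k-1}(Y_n)$ lie in $[1-C/\sqrt n,\,1+C/\sqrt n]$; (2) there is a cochain $a_n\in C^{k-1}(Y_n;\mathbb Z_2)$ with $\|[a_n]\|\geq \tfrac12-o(1)$ and $\|\delta a_n\|\leq C\log n/n$ (as $n\to\infty$); (3) the reduced integral homology groups satisfy $\tilde H_i(Y_n;\mathbb Z)=0$ for all $i\leq k-1$.
   Context: Complexes have linearly ordered vertex sets; $X_i$ is the set of $i$-faces, $[F:G]$ the oriented incidence number ($[F:G]=(-1)^j$ if $F\setminus G=\{v_j\}$ with $F=\{v_0<\dots<v_i\}$, $0$ if $G\not\subseteq F$). $\deg(F)$ is the number of $k$-faces containing $F$; pure means all maximal faces have dimension $k$. Coboundary: $(\delta f)(H)=\sum_{G}[H:G]f(G)$ (over $\mathbb R$ or $\mathbb Z_2$). $A_{k-1}(X)$: $X_{k-1}\times X_{k-1}$ matrix with entry $[F:F\cap G][G:F\cap G]$ if $|F\cap G|=k-1$ and $F\cup G\in X_k$, else $0$. $\Delta^{\mathrm{up}}_{k-1}(X)=I-D_{k-1}^{-1}A_{k-1}(X)$ with $D_{k-1}$ the diagonal degree matrix; it is self-adjoint for $\langle f,g\rangle=\sum_{F\in X_{k-1}}\deg(F)f(F)g(F)$, and its nontrivial eigenvalues are the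 eigenvalues of its restriction to the orthogonal complement (w.r.t. this inner product) of $B^{k-1}(X;\mathbb R)=\operatorname{im}\delta_{k-2}$. For $\mathbb Z_2$-cochains, $\|f\|=|\{F\in X_i: f(F)=1\}|/|X_i|$ for $f\in C^i(X;\mathbb Z_2)$, and $\|[f]\|=\min\{\|f+\delta g\|: g\in C^{i-1}(X;\mathbb Z_2)\}$.
   Formalization: The properties are claimed for all n at least some N0 depending on k, not for every n: for n ≤ k no pure k-dimensional complex on n vertices with complete (k-1)-skeleton exists; the finitely many remaining n follow by taking the complete k-dimensional complex and enlarging C. *)

(* Defs.v *)
From HB Require Import structures.
From Stdlib Require Import Reals ZArith.
From mathcomp Require Import all_boot.

Set Implicit Arguments.
Unset Strict Implicit.
Unset Printing Implicit Defensive.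

(* A simplicial complex on the (linearly ordered) vertex set 'I_n is a
   downward-closed family of finite sets of vertices (the empty face, of
   dimension -1, is included as soon as the complex is nonempty). *)
Definition is_complex (n : nat) (X : {set {set 'I_n}}) : Prop :=
  forall F G : {set 'I_n}, F \in X -> G \subset F -> G \in X.

(* faces of cardinality s, i.e. the (s-1)-faces: X_{s-1} = faces X s *)
Definition faces (n : nat) (X : {set {set 'I_n}}) (s : nat) : {set {set 'I_n}} :=
  [set F in X | #|F| == s].

Definition pure_dim (n : nat) (X : {set {set 'I_n}}) (k : nat) : Prop :=
  forall F, F \in X -> (forall H, H \in X -> F \subset H -> H = F) -> #|F| = k.+1.

Definition complete_skel (n : nat) (X : {set {set 'I_n}}) (k : nat) : Prop :=
  forall F : {set 'I_n}, #|F| <= k -> F \in X.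

Definition facet (n : nat) (G F : {set 'I_n}) : bool :=
  (G \subset F) && (#|F :\: G| == 1).

(* if F \ G = {v_j} with F = {v_0 < ... < v_i}, this is j *)
Definition incpos (n : nat) (F G : {set 'I_n}) : nat :=
  \sum_(v in F :\: G) #|[set u in F | val u < val v]|.

Definition incR (n : nat) (F G : {set 'I_n}) : R :=
  if facet G F then pow (Ropp R1) (incpos F G) else R0.
Definition incZ (n : nat) (F G : {set 'I_n}) : Z :=
  if facet G F then Z.pow (Z.opp 1%Z) (Z.of_nat (incpos F G)) else 0%Z.

Definition deg (n : nat) (X : {set {set 'I_n}}) (k : nat) (F : {set 'I_n}) : nat :=
  #|[set H in faces X k.+1 | F \subset H]|.

Local Open Scope R_scope.

Definition rsum (n : nat) (A : {set {set 'I_n}}) (f : {set 'I_n} -> R) : R :=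
  \big[Rplus/0]_(F in A) f F.

Definition Aup (n : nat) (X : {set {set 'I_n}}) (k : nat) (F G : {set 'I_n}) : R :=
  if (#|F :&: G| == k.-1)%N && (F :|: G \in X)
  then incR F (F :&: G) * incR G (F :&: G) else 0.

Definition Lap_up (n : nat) (X : {set {set 'I_n}}) (k : nat)
    (f : {set 'I_n} -> R) (F : {set 'I_n}) : R :=
  f F - / INR (deg X k F) * rsum (faces X k) (fun G => Aup X k F G * f G).

Definition cobR (n : nat) (X : {set {set 'I_n}}) (s : nat)
    (g : {set 'I_n} -> R) (H : {set 'I_n}) : R :=
  rsum (faces X s) (fun G => incR H G * g G).

Definition inner (n : nat) (X : {set {set 'I_n}}) (k : nat) (f g : {set 'I_n} -> R) : R :=
  rsum (faces X k) (fun F => INR (deg X k F) * f F * g F).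

(* lam is a nontrivial eigenvalue of Delta^up_{k-1}(X): an eigenvalue of its
   restriction to the orthogonal complement of B^{k-1} = im delta_{k-2} *)
Definition nontrivial_eig (n : nat) (X : {set {set 'I_n}}) (k : nat) (lam : R) : Prop :=
  exists f : {set 'I_n} -> R,
    (exists F, F \in faces X k /\ f F <> 0) /\
    (forall g : {set 'I_n} -> R, inner X k f (cobR X k.-1 g) = 0) /\
    (forall F, F \in faces X k -> Lap_up X k f F = lam * f F).

Definition cob2 (n : nat) (X : {set {set 'I_n}}) (s : nat)
    (g : {set 'I_n} -> bool) (H : {set 'I_n}) : bool :=
  \big[addb/false]_(G in faces X s | facet G H) g G.

Definition norm2 (n : nat) (X : {set {set 'I_n}}) (s : nat) (f : {set 'I_n} -> bool) : R :=
  INR #|[set F in faces X s | f F]| / INR #|faces X s|.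

Definition class_norm2 (n : nat) (X : {set {set 'I_n}}) (s : nat) (f : {set 'I_n} -> bool) : R :=
  INR (\big[minn/#|faces X s|]_(g : {ffun {set 'I_n} -> bool})
         #|[set F in faces X s | f F (+) cob2 X s.-1 g F]|)
  / INR #|faces X s|.

Local Close Scope R_scope.

Definition bdZ (n : nat) (X : {set {set 'I_n}}) (s : nat)
    (c : {set 'I_n} -> Z) (G : {set 'I_n}) : Z :=
  \big[Z.add/0%Z]_(F in faces X s) (incZ F G * c F)%Z.

(* reduced homology H~_i(X;Z) = 0 : every reduced i-cycle is an i-boundary
   (the augmentation is the boundary into the empty (-1)-face) *)
Definition red_hom_vanishes (n : nat) (X : {set {set 'I_n}}) (i : nat) : Prop :=
  forall c : {set 'I_n} -> Z,
    (forall G, G \in faces X i -> bdZ X i.+1 c G = 0%Z) ->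
    exists d : {set 'I_n} -> Z,
      forall F, F \in faces X i.+1 -> c F = bdZ X i.+2 d F.

(* Main.v *)
Require Import Defs.
From HB Require Import structures.
From Stdlib Require Import Reals ZArith.
From mathcomp Require Import all_boot all_order all_algebra.
From mathcomp Require Import ring lra zify ssrZ.
From mathcomp Require Import reals Rstruct.

(* Take a random cochain [a] and let the top faces be the [k+1]-sets [H] with
   [delta a (H) = 0], together with all those containing a fixed vertex [v0].
   The cone over [v0] kills the homology, and only the O(1/n) fraction of faces
   through [v0] can carry [delta a].

   For a fixed vertex [w] the signs [s(H) = (-1)^(delta a (H))], [w \in H], are
   independent, so by Hoeffding's inequality and a net argument every link matrix
   [s(W + x + y)], [#|W| = k - 1], has norm O(sqrt n) with overwhelming
   probability, all degrees are at least [n/4], and [a] is almost balanced against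
   every coboundary; a union bound gives an [a] with all three properties.

   The quadratic form of [A_{k-1}] is a sum over [W] of the forms of the link
   matrices, and each of these is a multiple of the all-ones matrix up to
   O(sqrt n).  Hence the form at [f] is controlled by the boundary of [f], which
   is small when [f] is orthogonal to the coboundaries. *)
Set Implicit Arguments.
Unset Strict Implicit.
Unset Printing Implicit Defensive.

Import Order.TTheory GRing.Theory Num.Theory.
Local Open Scope ring_scope.

Local Bind Scope ring_scope with R.
Local Arguments Rtrigo_def.exp x%_ring_scope.

(** The obstacle is that orthogonality to the coboundaries is weighted by the degrees: it kills the
    boundary of [D f], not that of [f], and the degrees fluctuate. Sharp degree concentration is
    avoided by the identity [A = D - delta^T t delta], with [t] the indicator of the top faces: it
    makes the form of [A] vanish between such an [f] and any coboundary, and localization to links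
    then bounds the boundary of [f] itself. A lower bound of order [n] on the degrees suffices at
    the end, because the eigenvalue equation turns the form at [f] into [1 - lam] times the weighted
    square norm of [f]. The apex costs little. If [v0 \in W], the link matrix of [W] is all-ones off
    the diagonal; otherwise only the row and column of [v0] are altered, a change of norm O(sqrt n).
    Independence of the signs needs a vertex common to all the sets considered, and [W] provides one
    because [k >= 2]. *)

Section Facets.
Variable n : nat.
Implicit Types (F G H W : {set 'I_n}) (x y : 'I_n).

Lemma facetP G F : reflect (exists2 x, x \notin G & F = x |: G) (facet G F).
Proof.
apply: (iffP andP) => [[sGF /cards1P[x FGx]]|[x xG ->]].
  have : x \in F :\: G by rewrite FGx set11.
  rewrite inE => /andP[xG xF]; exists x => //.
  by rewrite -FGx -[LHS](setID F G) (setIidPr sGF) setUC.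
split; first exact: subsetUr.
by rewrite setDUl setDv setU0 (setDidPl _) ?cards1 // disjoints1.
Qed.

Lemma facet_setU1 G x : x \notin G -> facet G (x |: G).
Proof. by move=> xG; apply/facetP; exists x. Qed.

Lemma facet_card G F : facet G F -> #|F| = #|G|.+1.
Proof. by case/facetP => x xG ->; rewrite cardsU1 xG. Qed.

Lemma facet_sub G F : facet G F -> G \subset F.
Proof. by case/andP. Qed.

Lemma facetE G F : #|F| = #|G|.+1 -> facet G F = (G \subset F).
Proof.
move=> FG; rewrite /facet; case: (boolP (G \subset F)) => //= sGF.
by rewrite cardsD (setIidPr sGF) FG subSnn.
Qed.

Lemma setU1_inj G : {in [pred x | x \notin G] &, injective (fun x => x |: G)}.
Proof.
move=> x y xG yG /= e; have : x \in y |: G by rewrite -e setU11.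
by rewrite in_setU1 (negPf xG) orbF => /eqP.
Qed.

Lemma big_cofacets (T : Type) (idx : T) (op : Monoid.com_law idx) G
    (f : {set 'I_n} -> T) :
  \big[op/idx]_(F | facet G F) f F = \big[op/idx]_(x | x \notin G) f (x |: G).
Proof.
rewrite (eq_bigl [in [set x |: G | x in [pred x | x \notin G]]]); last first.
  move=> F; apply/facetP/imsetP => -[x xG ->]; by exists x.
by rewrite big_imset //; exact: setU1_inj.
Qed.

Lemma big_facets (T : Type) (idx : T) (op : Monoid.com_law idx) F
    (f : {set 'I_n} -> T) :
  \big[op/idx]_(G | facet G F) f G = \big[op/idx]_(x in F) f (F :\ x).
Proof.
rewrite (eq_bigl [in [set F :\ x | x in F]]); last first.
  move=> G; apply/facetP/imsetP => [[x xG ->]|[x xF ->]].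
    by exists x; rewrite ?setU11 // setU1K.
  by exists x; rewrite ?setD11 // setD1K.
rewrite big_imset // => x y xF yF /= e.
apply/eqP; apply: contraTT xF => nxy.
have : x \notin F :\ y by rewrite -e setD11.
by rewrite !inE nxy.
Qed.

Lemma card_notin F : #|[pred x | x \notin F]| = (n - #|F|)%N.
Proof.
have := cardC F; rewrite card_ord.
have -> : #|[predC F]| = #|[pred x | x \notin F]| by apply: eq_card.
by lia.
Qed.

Definition pos W x : nat := #|[set u in W | (val u < val x)%N]|.

Lemma pos_setU1 W x y : y \notin W -> pos (y |: W) x = ((y < x) + pos W x)%N.
Proof.
move=> yW; rewrite /pos.
have -> : [set u in y |: W | (val u < val x)%N] =
   (if (y < x)%N then [set y] else set0) :|: [set u in W | (val u < val x)%N].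
  apply/setP => u; rewrite !inE; case: (boolP (y < x)%N) => yx; rewrite !inE;
  case: (eqVneq u y) => [->|] //=; rewrite ?yx ?(negPf yW) ?(negPf yx) //.
by case: ifP => yx; rewrite ?set0U // cardsU1 inE (negPf yW).
Qed.

Lemma pos_setU1id W x : x \notin W -> pos (x |: W) x = pos W x.
Proof. by move=> xW; rewrite pos_setU1 // ltnn. Qed.

Lemma incpos_setU1 W x : x \notin W -> incpos (x |: W) W = pos W x.
Proof.
move=> xW; rewrite /incpos.
rewrite (_ : _ :\: _ = [set x]) ?big_set1; last first.
  by rewrite setDUl setDv setU0 (setDidPl _) // disjoints1.
exact: pos_setU1id.
Qed.

End Facets.

(** * Oriented incidence numbers and their sign rules *)

Section Incidence.
Variables (R : comNzRingType) (n : nat).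
Implicit Types (F G H W : {set 'I_n}) (x y : 'I_n).

(** Over an arbitrary ring, since the real Laplacian and the integral boundary use the same
    signs. *)
Definition inc F G : R := if facet G F then (-1) ^+ incpos F G else 0.

Lemma inc_setU1 W x : x \notin W -> inc (x |: W) W = (-1) ^+ pos W x.
Proof. by move=> xW; rewrite /inc facet_setU1 // incpos_setU1. Qed.

Lemma inc_sqr F G : facet G F -> inc F G * inc F G = 1.
Proof. by rewrite /inc => ->; rewrite -expr2 sqrr_sign. Qed.

Lemma sum_inc_up (g : {set 'I_n} -> R) G :
  \sum_F inc F G * g F = \sum_(x | x \notin G) inc (x |: G) G * g (x |: G).
Proof.
rewrite -(big_cofacets _ G (fun F => inc F G * g F)) /= [RHS]big_mkcond /=.
by apply: eq_bigr => F _; rewrite /inc; case: ifP; rewrite ?mul0r.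
Qed.

(** The later of [x] and [y] has its position raised by one when the other is already present, so
    exactly one of the two orders of insertion picks up an extra sign. *)
Lemma inc_exchange W x y : x \notin W -> y \notin W -> x != y ->
  inc (x |: (y |: W)) (y |: W) * inc (y |: W) W =
  - (inc (y |: (x |: W)) (x |: W) * inc (x |: W) W).
Proof.
move=> xW yW xy; have yx : y != x by rewrite eq_sym.
rewrite !inc_setU1 ?inE ?negb_or ?xy ?yx // !pos_setU1 //.
rewrite -!exprD -addnA [(pos W x + pos W y)%N]addnC -addnA !exprD -mulNr.
congr (_ * _); case: ltngtP => [||e]; rewrite ?expr1 ?expr0 ?opprK //.
by rewrite (val_inj e) eqxx in xy.
Qed.

(** Only the two sets between [W] and [H] contribute, and [inc_exchange] makes them cancel. *)
Lemma inc_inc0 H W : \sum_F inc H F * inc F W = 0.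
Proof.
under eq_bigr => F _ do rewrite mulrC.
rewrite sum_inc_up.
case: (boolP [exists x, (x \notin W) && facet (x |: W) H]); last first.
  move=> /existsPn h; rewrite big1 // => x xW; move: (h x); rewrite xW /= => hx.
  by rewrite [inc H _]/inc (negPf hx) mulr0.
case/existsP => x /andP[xW /facetP[y yxW eH]].
move: yxW; rewrite in_setU1 negb_or => /andP[yx yW].
rewrite (bigD1 x) //= (bigD1 y) /=; last by rewrite yW yx.
rewrite big1 ?addr0 => [|z /andP[/andP[zW zx] zy]]; last first.
  rewrite [inc H _]/inc ifN ?mulr0 //; apply/negP => /facet_sub/subsetP/(_ z).
  by rewrite eH !inE eqxx (negPf zW) (negPf zx) (negPf zy) => /(_ isT).
rewrite eH mulrC inc_exchange //.
by rewrite setUCA [inc (y |: W) W * _]mulrC addNr.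
Qed.

(** [Aup] is signed through [F :&: G], the coboundary through [F :|: G]; this converts one into the
    other. *)
Lemma inc_up_down W x y : x \notin W -> y \notin W -> x != y ->
  inc (x |: (y |: W)) (x |: W) * inc (x |: (y |: W)) (y |: W) =
  - (inc (x |: W) W * inc (y |: W) W).
Proof.
move=> xW yW xy; have := inc_exchange xW yW xy.
move=> /(congr1 (fun z => inc (y |: W) W * inc (y |: (x |: W)) (x |: W) * z)).
rewrite [x |: (y |: W)]setUCA => e.
have fy : facet W (y |: W) by exact: facet_setU1.
have fx : facet (x |: W) (y |: (x |: W)).
  by apply: facet_setU1; rewrite in_setU1 negb_or yW eq_sym xy.
transitivity (inc (y |: W) W * inc (y |: (x |: W)) (x |: W) *
   (inc (y |: (x |: W)) (y |: W) * inc (y |: W) W)).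
  rewrite -[LHS](mul1r) -(inc_sqr fy); ring.
by rewrite e -[in RHS](mul1r (inc (x |: W) W)) -(inc_sqr fx); ring.
Qed.

End Incidence.

(** * Bilinear form of the weighted up-adjacency matrix *)

Section UpForm.
Variables (R : comNzRingType) (n k : nat).
Hypothesis k_gt0 : (0 < k)%N.
Implicit Types (F G H W : {set 'I_n}) (x y : 'I_n) (f g t : {set 'I_n} -> R).

Local Notation ic := (@inc R n).

Definition card_sets s : {set {set 'I_n}} := [set F : {set 'I_n} | #|F| == s].

Local Notation K := card_sets.

(** [cob] and [bd] range over all sets of the right cardinality: below the top dimension these are
    the faces, by completeness of the skeleton, and on top sets the weight [t] does the
    selection. *)
Definition cob g F : R := \sum_(W in K (#|F|).-1) ic F W * g W.
Definition bd s f W : R := \sum_(F in K s) ic F W * f F.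

Definition up_coef t F G : R :=
  if #|F :&: G| == k.-1 then ic F (F :&: G) * ic G (F :&: G) * t (F :|: G)
  else 0.

Definition up_form t f g : R :=
  \sum_(F in K k) \sum_(G in K k) up_coef t F G * (f F * g G).

Definition up_deg t F : R := \sum_(y | y \notin F) t (y |: F).

Definition link_val f W x : R := ic (x |: W) W * f (x |: W).

Lemma inc_eq0 F G : #|F| != #|G|.+1 -> ic F G = 0.
Proof.
by move=> nFG; rewrite /inc; case: ifP => // /facet_card e; rewrite e eqxx in nFG.
Qed.

Lemma cobE g F : (0 < #|F|)%N -> cob g F = \sum_W ic F W * g W.
Proof.
move=> F0; rewrite /cob big_mkcond /=; apply: eq_bigr => W _; rewrite inE.
case: eqP => // e; rewrite inc_eq0 ?mul0r //; apply/eqP => e'.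
by apply: e; rewrite e'.
Qed.

Lemma bdE s f W : #|W|.+1 = s -> bd s f W = \sum_F ic F W * f F.
Proof.
move=> Ws; rewrite /bd big_mkcond /=; apply: eq_bigr => F _; rewrite inE.
by case: eqP => // e; rewrite inc_eq0 ?mul0r // Ws; apply/eqP.
Qed.

Lemma bd_link f W : #|W| = k.-1 -> bd k f W = \sum_(x | x \notin W) link_val f W x.
Proof. by move=> cW; rewrite bdE ?cW ?prednK // sum_inc_up. Qed.

Lemma cob_cob0 g H : (1 < #|H|)%N -> cob (cob g) H = 0.
Proof.
move=> H1; rewrite cobE; last by apply: leq_trans H1.
transitivity (\sum_F \sum_W (ic H F * ic F W) * g W).
  apply: eq_bigr => F _; case: (eqVneq #|H| #|F|.+1) => HF; last first.
    by rewrite inc_eq0 // mul0r big1 // => W _; rewrite !mul0r.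
  rewrite cobE; last by move: H1; rewrite HF ltnS.
  by rewrite mulr_sumr; apply: eq_bigr => W _; rewrite mulrA.
rewrite exchange_big big1 //= => W _.
by rewrite -mulr_suml inc_inc0 mul0r.
Qed.

Lemma cob_bd_adjoint f g :
  \sum_(F in K k) f F * cob g F = \sum_(W in K k.-1) bd k f W * g W.
Proof.
rewrite /bd; under [RHS]eq_bigr => W _ do rewrite mulr_suml.
rewrite exchange_big /=; apply: eq_bigr => F; rewrite inE => /eqP cF.
by rewrite /cob cF mulr_sumr; apply: eq_bigr => W _; ring.
Qed.

Lemma sum_link (q : {set 'I_n} -> {set 'I_n} -> R) :
  \sum_(W in K k.-1) \sum_(x | x \notin W) q W (x |: W) =
  \sum_(F in K k) \sum_(W | facet W F) q W F.
Proof.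
under eq_bigr => W _ do rewrite -(big_cofacets _ _ (q W)).
rewrite (exchange_big_dep [in K k]) /= => [|W F]; last first.
  by rewrite !inE => /eqP cW /facet_card ->; rewrite cW prednK.
apply: eq_bigr => F; rewrite inE => /eqP cF; apply: eq_bigl => W.
rewrite inE andbC; case: (boolP (facet W F)) => //= /facet_card.
by rewrite cF -{1}(prednK k_gt0) => -[->]; rewrite eqxx.
Qed.

(** Each [k]-set is counted once for each of its [k] facets; this is the loss factor of the
    localization. *)
Lemma sum_link_sqr f :
  \sum_(W in K k.-1) \sum_(x | x \notin W) link_val f W x ^+ 2 =
  k%:R * \sum_(F in K k) f F ^+ 2.
Proof.
rewrite (sum_link (fun W F => (ic F W * f F) ^+ 2)) mulr_sumr.
apply: eq_bigr => F; rewrite inE => /eqP cF.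
transitivity (\sum_(W | facet W F) f F ^+ 2).
  by apply: eq_bigr => W WF; rewrite exprMn expr2 inc_sqr // mul1r.
by rewrite (big_facets _ _ (fun=> f F ^+ 2)) /= sumr_const cF mulr_natl.
Qed.

(** Garland's localization: two [k]-sets meeting in [k - 1] vertices determine [W = F :&: G], so
    pairs can be grouped by [W], and the signs are absorbed into [link_val]. *)
Lemma up_form_link t f g : up_form t f g =
  \sum_(W in K k.-1) \sum_(x | x \notin W) \sum_(y | (y \notin W) && (y != x))
    t (x |: (y |: W)) * (link_val f W x * link_val g W y).
Proof.
pose q W F G := if F :&: G == W then
   ic F W * ic G W * t (F :|: G) * (f F * g G) else 0.
transitivity (\sum_(W in K k.-1) \sum_(F in K k) \sum_(G in K k) q W F G).
  rewrite exchange_big /=; apply: eq_bigr => F _.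
  rewrite exchange_big /=; apply: eq_bigr => G _.
  rewrite /up_coef; case: ifP => [cFG|cFG].
    rewrite (bigD1 (F :&: G)) ?inE //= /q eqxx big1 ?addr0 // => W /andP[_ nW].
    by rewrite eq_sym (negPf nW).
  rewrite mul0r big1 // => W; rewrite inE /q => cW.
  by case: eqP => // e; rewrite e cW in cFG.
apply: eq_bigr => W; rewrite inE => /eqP cW.
have red (h : {set 'I_n} -> R) : (forall F, ~~ (W \subset F) -> h F = 0) ->
    \sum_(F in K k) h F = \sum_(x | x \notin W) h (x |: W).
  move=> h0; rewrite -(big_cofacets _ W h) /= big_mkcond [RHS]big_mkcond /=.
  apply: eq_bigr => F _; rewrite inE; case: eqP => [cF|cF].
    rewrite facetE; last by rewrite cF cW prednK.
    by case: ifP => // /negbT; exact: h0.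
  by case: ifP => // /facet_card; rewrite cW prednK.
rewrite red; last first.
  move=> F WF; apply: big1 => G _; rewrite /q; case: eqP => // e.
  by rewrite -e subsetIl in WF.
apply: eq_bigr => x xW; rewrite red; last first.
  move=> F WF; rewrite /q; case: eqP => // e.
  by rewrite -e subsetIr in WF.
rewrite big_mkcondr /=; apply: eq_bigr => y yW; rewrite /q /link_val.
rewrite -setUIl (_ : [set x] :&: [set y] = if y != x then set0 else [set x]).
  case: (eqVneq y x) => [yx|yx] /=.
    rewrite ifN //; apply/eqP => e; have : x \in W by rewrite -e setU11.
    by rewrite (negPf xW).
  rewrite set0U eqxx (_ : x |: W :|: (y |: W) = x |: (y |: W)); first by ring.
  by apply/setP => z; rewrite !inE; do ?case: (_ == _); case: (_ \in _).
apply/setP => z; case: (eqVneq y x) => [->|yx]; rewrite !inE ?andbb //=.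
by apply/negP => /andP[/eqP -> ]; rewrite eq_sym (negPf yx).
Qed.

(** For [F != G] the only possible common coface is [F :|: G], which has [k + 1] elements exactly
    when [F :&: G] has [k - 1]. *)
Lemma sum_inc_pair t F G : F \in K k -> G \in K k ->
  \sum_(H in K k.+1) t H * (ic H F * ic H G) =
  (if F == G then up_deg t F else 0) - up_coef t F G.
Proof.
rewrite !inE => /eqP cF /eqP cG; case: eqVneq => [<-|FG].
  rewrite /up_coef setIid cF ifN; last by rewrite -{1}(prednK k_gt0) eqn_leq ltnn.
  rewrite subr0 /up_deg -(big_cofacets _ F t) /= big_mkcond [RHS]big_mkcond /=.
  apply: eq_bigr => H _; rewrite inE; case: ifP => [cH|cH].
    case: ifP => fH; first by rewrite inc_sqr // mulr1.
    by rewrite /inc fH !mul0r mulr0.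
  by case: ifP => // /facet_card e; rewrite e cF eqxx in cH.
rewrite sub0r /up_coef; case: ifP => cFG; last first.
  rewrite oppr0 big1 // => H _; rewrite /inc.
  case: ifP => fF; rewrite ?mul0r ?mulr0 //; case: ifP => fG; rewrite ?mulr0 //.
  case/negP: cFG; case/facetP: fF => x xF eH; rewrite eH in fG.
  case/facetP: fG => y yG eH'.
  have yF : y \in F.
    have : y \in x |: F by rewrite eH' setU11.
    rewrite in_setU1 => /predU1P[e|//]; case/eqP: FG.
    by rewrite -(setU1K xF) -(setU1K yG) -eH' e.
  rewrite (_ : F :&: G = F :\ y); first by rewrite -cF [#|F|](cardsD1 y) yF.
  apply/setP => z; rewrite !inE; case: (boolP (z \in F)) => zF; last by rewrite andbF.
  have := setU1r x zF; rewrite eH' !inE; case: eqVneq => [->|] //= _.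
  by rewrite (negPf yG).
have cardD (A B : {set 'I_n}) : #|A| = k -> #|A :&: B| == k.-1 ->
    exists2 x, x \notin A :&: B & A = x |: (A :&: B).
  move=> cA cAB; apply/facetP; rewrite facetE ?subsetIl //.
  by rewrite (eqP cAB) cA prednK.
have [x xW eF] := cardD F G cF cFG.
have [y yW eG] : exists2 y, y \notin F :&: G & G = y |: (F :&: G).
  by rewrite setIC; apply: cardD; rewrite // setIC.
set W := F :&: G in xW eF yW eG cFG *; clearbody W.
have xy : x != y by apply: contraNneq FG => e; rewrite eF eG e.
have eFG : F :|: G = x |: (y |: W).
  by rewrite eF eG; apply/setP => z; rewrite !inE; do ?case: (_ == _); case: (_ \in _).
rewrite eFG (bigD1 (x |: (y |: W))) /=; last first.
  by rewrite inE !cardsU1 in_setU1 negb_or xy xW yW (eqP cFG) !add1n prednK.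
rewrite big1 ?addr0 => [|H /andP[]]; last first.
  rewrite inE => /eqP cH nH; rewrite /inc.
  case: ifP => fF; rewrite ?mul0r ?mulr0 //; case: ifP => fG; rewrite ?mulr0 //.
  case/eqP: nH; apply/esym/eqP; rewrite eqEcard -eFG subUset !facet_sub //= cH.
  rewrite eFG !cardsU1 in_setU1 negb_or xy xW yW (eqP cFG) !add1n prednK //.
have -> : ic (x |: (y |: W)) F * ic (x |: (y |: W)) G = - (ic F W * ic G W).
  by have := inc_up_down R xW yW xy; rewrite -eFG -eF -eG.
by ring.
Qed.

(** The identity [A = D - delta^T t delta]. Its use is that the second sum vanishes as soon as [g]
    is itself a coboundary. *)
Lemma up_form_cob t f g : up_form t f g =
  \sum_(F in K k) up_deg t F * (f F * g F) -
  \sum_(H in K k.+1) t H * (cob f H * cob g H).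
Proof.
have -> : \sum_(H in K k.+1) t H * (cob f H * cob g H) =
   \sum_(F in K k) \sum_(G in K k)
     (f F * g G) * \sum_(H in K k.+1) t H * (ic H F * ic H G).
  transitivity (\sum_(H in K k.+1) \sum_(F in K k) \sum_(G in K k)
     (f F * g G) * (t H * (ic H F * ic H G))).
    apply: eq_bigr => H; rewrite inE => /eqP cH; rewrite /cob cH /=.
    rewrite big_distrl /= mulr_sumr; apply: eq_bigr => F _.
    by rewrite !mulr_sumr; apply: eq_bigr => G _; ring.
  rewrite exchange_big /=; apply: eq_bigr => F _.
  rewrite exchange_big /=; apply: eq_bigr => G _.
  by rewrite mulr_sumr.
rewrite -sumrB; apply: eq_bigr => F FK.
transitivity (up_deg t F * (f F * g F) - \sum_(G in K k)
   ((if F == G then up_deg t F * (f F * g F) else 0) - up_coef t F G * (f F * g G))).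
  rewrite sumrB -big_mkcondr /=.
  rewrite [X in _ - (X - _)](big_pred1 F) ?subKr // => G /=.
  by rewrite eq_sym; case: eqP => [->|]; rewrite ?andbF ?FK.
congr (_ - _); apply: eq_bigr => G GK; rewrite sum_inc_pair //.
by case: eqP => [<-|_]; ring.
Qed.

End UpForm.

(** * From link estimates to the quadratic form *)

Section Spectral.
Variables (R : realFieldType) (n k : nat) (v0 : 'I_n).
Hypothesis k_gt0 : (0 < k)%N.
Implicit Types (F G H W : {set 'I_n}) (x y : 'I_n) (f g t : {set 'I_n} -> R).

Local Notation K := (@card_sets n).

(** The typical value of [t] on a top set over [W]: sets through [v0] are always faces, any other
    set is one with probability 1/2. *)
Definition cone_weight W : R := if v0 \in W then 1 else 2^-1.

Definition link_form t W (u v : 'I_n -> R) : R :=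
  \sum_(x | x \notin W) \sum_(y | (y \notin W) && (y != x))
     t (x |: (y |: W)) * (u x * v y).

Definition link_error t W (u v : 'I_n -> R) : R :=
  link_form t W u v -
    cone_weight W * ((\sum_(x | x \notin W) u x) * (\sum_(x | x \notin W) v x)).

(** [tau] balances arguments of different sizes: [g] will be the coboundary of the boundary of [f],
    whose norm turns out to be at most [tau] times that of [f]. *)
Lemma up_form_error t (E tau : R) f g :
  (forall W u v, W \in K k.-1 -> `|link_error t W u v| <=
     E * (tau * (\sum_(x | x \notin W) u x ^+ 2) +
          tau^-1 * (\sum_(x | x \notin W) v x ^+ 2))) ->
  `|up_form k t f g -
     \sum_(W in K k.-1) cone_weight W * (bd k f W * bd k g W)| <=
  E * k%:R * (tau * (\sum_(F in K k) f F ^+ 2) +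
              tau^-1 * (\sum_(F in K k) g F ^+ 2)).
Proof.
move=> hE; rewrite up_form_link // -sumrB; apply: le_trans (ler_norm_sum _ _ _) _.
have -> : E * k%:R * (tau * (\sum_(F in K k) f F ^+ 2) +
              tau^-1 * (\sum_(F in K k) g F ^+ 2)) =
  \sum_(W in K k.-1) E * (tau * (\sum_(x | x \notin W) link_val f W x ^+ 2) +
          tau^-1 * (\sum_(x | x \notin W) link_val g W x ^+ 2)).
  rewrite -mulr_sumr big_split /= -!mulr_sumr !sum_link_sqr //; ring.
apply: ler_sum => W WK; have := WK; rewrite inE => /eqP cW.
by rewrite !bd_link //; exact: (hE W (link_val f W) (link_val g W) WK).
Qed.

(* For [W] through the cone vertex the degrees are constant, so the boundary
   of [f] vanishes there.  Elsewhere [delta o delta = 0] makes [up_form f] vanish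
   on coboundaries; testing against [delta (bd f)] bounds the boundary of [f]. *)
Lemma up_form_bound t f (E : R) : 0 < E -> (1 < k)%N ->
  (forall H, v0 \in H -> t H = 1) ->
  (forall W u v tau, W \in K k.-1 -> 0 < tau -> `|link_error t W u v| <=
     E * (tau * (\sum_(x | x \notin W) u x ^+ 2) +
          tau^-1 * (\sum_(x | x \notin W) v x ^+ 2))) ->
  (k < n)%N ->
  (forall W, W \in K k.-1 -> bd k (fun F => up_deg t F * f F) W = 0) ->
  `|up_form k t f f| <= 4 * E * k%:R * \sum_(F in K k) f F ^+ 2.
Proof.
move=> E0 k1 t1 hE kn fB.
have err g tau (tau0 : 0 < tau) :=
  @up_form_error t E tau f g (fun W u v WK => hE W u v tau WK tau0).
have degc F : F \in K k -> v0 \in F -> up_deg t F = (n - k)%:R.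
  rewrite inE => /eqP cF vF; rewrite /up_deg (eq_bigr (fun=> 1)); last first.
    by move=> y _; rewrite t1 // inE vF orbT.
  rewrite sumr_const; congr (_%:R).
  by rewrite card_notin cF.
have bd0 W : W \in K k.-1 -> v0 \in W -> bd k f W = 0.
  move=> WK vW; have := fB W WK; rewrite /bd.
  rewrite (eq_bigr (fun F => (n - k)%:R * (inc R F W * f F))); last first.
    move=> F FK; rewrite /inc; case: ifP => fF; last by rewrite !mul0r mulr0.
    rewrite degc //; first by ring.
    by apply: (subsetP (facet_sub fF)).
  rewrite -mulr_sumr => /eqP; rewrite mulf_eq0 pnatr_eq0 subn_eq0 leqNgt kn /=.
  by move/eqP.
have half g : \sum_(W in K k.-1) cone_weight W * (bd k f W * bd k g W) =
    2^-1 * \sum_(W in K k.-1) bd k f W * bd k g W.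
  rewrite mulr_sumr; apply: eq_bigr => W WK; rewrite /cone_weight.
  by case: ifP => // vW; rewrite bd0 // mul0r !mulr0.
set N := \sum_(F in K k) f F ^+ 2.
pose g := cob (bd k f); pose P := \sum_(F in K k) g F ^+ 2.
have N0 : 0 <= N by apply: sumr_ge0 => F _; rewrite sqr_ge0.
have P0 : 0 <= P by apply: sumr_ge0 => F _; rewrite sqr_ge0.
have kR : 0 < k%:R :> R by rewrite ltr0n.
have fg0 : up_form k t f g = 0.
  rewrite up_form_cob // [X in _ - X]big1 ?subr0; last first.
    move=> H; rewrite inE => /eqP cH.
    by rewrite /g [X in _ * (_ * X)]cob_cob0 ?cH // !mulr0.
  under eq_bigr => F _ do rewrite mulrA.
  rewrite cob_bd_adjoint; apply: big1 => W WK; by rewrite fB // mul0r.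
have bdg : \sum_(W in K k.-1) bd k f W * bd k g W = P.
  rewrite /P; under [RHS]eq_bigr => F _ do rewrite expr2 /g.
  by rewrite cob_bd_adjoint; apply: eq_bigr => W _; rewrite mulrC.
have bdf : \sum_(W in K k.-1) bd k f W * bd k f W = \sum_(F in K k) f F * g F.
  by rewrite cob_bd_adjoint.
(* This choice makes the error at [(f, g)] equal to [tau ^+ 2 * N / 4 + P / 4], whose second part is
   absorbed by the main term [P / 2]. *)
set tau := 4 * E * k%:R.
have tau0 : 0 < tau by rewrite /tau !mulr_gt0.
have Ek : E * k%:R = tau / 4 by rewrite /tau; field.
clearbody tau.
have PN : P <= tau ^+ 2 * N.
  have := err g tau tau0; rewrite fg0 half bdg sub0r normrN -/N -/P.
  rewrite ger0_norm; last by rewrite mulr_ge0 // invr_ge0.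
  rewrite Ek mulrDr -[X in _ + X]mulrA [X in _ + _ * X]mulrA.
  have -> : tau / 4 * (tau * N) = tau ^+ 2 * N / 4 by field.
  have -> : tau * (4^-1 * tau^-1 * P) = P / 4.
    by field; rewrite gt_eqF.
  by lra.
set Q := \sum_(F in K k) f F * g F in bdf *.
have QN : Q <= tau * N.
  have : Q <= 2^-1 * (tau * N + tau^-1 * P).
    rewrite /Q /N /P !mulr_sumr -big_split /= mulr_sumr; apply: ler_sum => F _.
    have := sqr_ge0 (tau * f F - g F); rewrite -(pmulr_rge0 _ (x := tau^-1)) ?invr_gt0 //.
    have -> : tau^-1 * (tau * f F - g F) ^+ 2 =
        tau * f F ^+ 2 - 2 * (f F * g F) + tau^-1 * g F ^+ 2.
      by field; rewrite gt_eqF.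
    by lra.
  have : tau^-1 * P <= tau * N.
    rewrite -(ler_pM2l tau0) !mulrA mulfV ?gt_eqF // mul1r -expr2.
    exact: PN.
  by lra.
have Q0 : 0 <= Q by rewrite -bdf; apply: sumr_ge0 => W _; rewrite -expr2 sqr_ge0.
(* At [(f, f)] the main term [Q / 2] and the error with weight 1 are each at most [tau * N / 2]. *)
have := err f 1 ltr01; rewrite half bdf invr1 !mul1r -/N Ek.
rewrite !ler_norml => /andP[h1 h2]; apply/andP; split.
  by move: h1; nra.
by move: h2; nra.
Qed.

End Spectral.

(** * Link matrices as perturbations of the all-ones matrix *)

Section LinkError.
Variables (R : rcfType) (n : nat) (v0 : 'I_n).
Variables (s t : {set 'I_n} -> R) (r c : R).
Implicit Types (W : {set 'I_n}) (u v : 'I_n -> R).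
Hypotheses (r_ge1 : 1 <= r) (r_sqr : r ^+ 2 = n%:R) (c_ge0 : 0 <= c).
Hypothesis s_le1 : forall H, `|s H| <= 1.
Hypothesis tE : forall H, t H = if v0 \in H then 1 else 2^-1 * (1 + s H).

Definition sq_norm W u : R := \sum_(x | x \notin W) u x ^+ 2.

Lemma sq_norm_ge0 W u : 0 <= sq_norm W u.
Proof. by apply: sumr_ge0 => x _; rewrite sqr_ge0. Qed.

(** Only [x < y], so that each top set over [W] occurs once, as independence of the random signs
    requires. *)
Definition upper_form W u v : R :=
  \sum_(x | x \notin W) \sum_(y | (y \notin W) && (x < y)%N)
    s (x |: (y |: W)) * (u x * v y).

Lemma link_form_upper W u v :
  link_form s W u v = upper_form W u v + upper_form W v u.
Proof.
rewrite /link_form /upper_form [X in _ + X](exchange_big_dep [pred x | x \notin W]) /=;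
  last by move=> x y _ /andP[].
rewrite -big_split /=; apply: eq_bigr => x xW.
rewrite (bigID (fun y : 'I_n => (x < y)%N)) /=; congr (_ + _).
  apply: eq_bigl => y; case: (y \notin W) => //=.
  by case: ltngtP => [xy|xy|/val_inj ->]; rewrite ?eqxx ?andbF ?andbT //;
    apply/eqP => e; rewrite e ltnn in xy.
apply: eq_big => y; rewrite ?xW /=.
  case: (y \notin W) => //=; rewrite -leqNgt leq_eqVlt -val_eqE /=.
  by case: eqP => [->|_] /=; rewrite ?ltnn.
by move=> _; rewrite setUCA [u x * _]mulrC.
Qed.

(** These weights fit a single row: [u x0] meets at most [n = r ^+ 2] entries, and
    [n * r^-1 = r]. *)
Lemma mul_le_weighted (a b : R) : `|a * b| <= 2^-1 * (r^-1 * a ^+ 2 + r * b ^+ 2).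
Proof.
have r0 : 0 < r by apply: lt_le_trans r_ge1.
have h (e : R) : e ^+ 2 = 1 -> e * (a * b) <= 2^-1 * (r^-1 * a ^+ 2 + r * b ^+ 2).
  move=> e1; have := sqr_ge0 (a - e * r * b).
  rewrite -(pmulr_rge0 _ (x := r^-1)) ?invr_gt0 //.
  have -> : r^-1 * (a - e * r * b) ^+ 2 =
     r^-1 * a ^+ 2 - 2 * (e * (a * b)) + e ^+ 2 * (r * b ^+ 2).
    by field; rewrite gt_eqF.
  by rewrite e1; lra.
rewrite ler_norml lerNl -mulN1r !h ?sqrrN ?expr1n //=.
by have := h 1; rewrite expr1n mul1r; apply.
Qed.

Lemma star_bound W u v (d : 'I_n -> 'I_n -> R) (x0 : 'I_n) :
  (forall x y, `|d x y| <= 1) ->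
  `|\sum_(x | x \notin W) \sum_(y | (y \notin W) && (y != x))
      (if x == x0 then d x y else 0) * (u x * v y)|
   <= 2^-1 * r * (sq_norm W u + sq_norm W v).
Proof.
move=> d1; have r0 : 0 < r by apply: lt_le_trans r_ge1.
have bnd : 0 <= 2^-1 * r * (sq_norm W u + sq_norm W v).
  by rewrite mulr_ge0 ?addr_ge0 ?sq_norm_ge0 // mulr_ge0 ?invr_ge0 // ltW.
case: (boolP (x0 \in W)) => x0W.
  rewrite big1 ?normr0 // => x xW; apply: big1 => y _.
  by rewrite ifN ?mul0r //; apply: contraNneq xW => ->.
rewrite (bigD1 x0) //= [X in _ + X]big1 ?addr0; last first.
  by move=> x /andP[_ xx]; apply: big1 => y _; rewrite (negPf xx) mul0r.
apply: le_trans (ler_norm_sum _ _ _) _.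
apply: (@le_trans _ _ (\sum_(y | y \notin W)
    2^-1 * (r^-1 * u x0 ^+ 2 + r * v y ^+ 2))).
  rewrite big_mkcondr /=; apply: ler_sum => y yW; case: ifP => _.
    rewrite eqxx normrM; apply: le_trans (mul_le_weighted _ _).
    by rewrite ler_piMl.
  by apply: le_trans (mul_le_weighted _ _).
rewrite -mulr_sumr -mulrA ler_pM2l ?invr_gt0 // big_split /=.
rewrite sumr_const -mulr_sumr mulrDr lerD2r.
have u0 : u x0 ^+ 2 <= sq_norm W u.
  rewrite /sq_norm (bigD1 x0) //= lerDl; apply: sumr_ge0 => x _; exact: sqr_ge0.
apply: le_trans (_ : r * u x0 ^+ 2 <= _); last by rewrite ler_pM2l.
rewrite -mulr_natr mulrAC ler_wpM2r ?sqr_ge0 // -(ler_pM2l r0) mulrA mulfV ?gt_eqF //.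
rewrite mul1r -expr2 r_sqr ler_nat; apply: leq_trans (max_card _) _.
by rewrite card_ord.
Qed.

Lemma diag_bound W u v :
  `|\sum_(x | x \notin W) u x * v x| <= 2^-1 * (sq_norm W u + sq_norm W v).
Proof.
apply: le_trans (ler_norm_sum _ _ _) _; rewrite -big_split /= mulr_sumr.
apply: ler_sum => x _; rewrite ler_norml.
by have := sqr_ge0 (u x - v x); have := sqr_ge0 (u x + v x); nra.
Qed.

Lemma sum_offdiag W u v :
  \sum_(x | x \notin W) \sum_(y | (y \notin W) && (y != x)) u x * v y =
  (\sum_(x | x \notin W) u x) * (\sum_(x | x \notin W) v x) -
  \sum_(x | x \notin W) u x * v x.
Proof.
rewrite mulr_suml -sumrB; apply: eq_bigr => x xW.
by rewrite mulr_sumr [in RHS](bigD1 x) //= addrAC subrr add0r.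
Qed.

Lemma link_error_sym W u v :
  (forall u v, `|upper_form W u v| <= c * r * (sq_norm W u + sq_norm W v)) ->
  `|link_error v0 t W u v| <= (c + 2) * r * (sq_norm W u + sq_norm W v).
Proof.
move=> hs; set S := sq_norm W u + sq_norm W v.
have S0 : 0 <= S by rewrite addr_ge0 ?sq_norm_ge0.
have D := diag_bound W u v; rewrite -/S in D.
rewrite /link_error /cone_weight; case: ifP => [vW|/negbT vW].
  rewrite /link_form (eq_bigr (fun x =>
      \sum_(y | (y \notin W) && (y != x)) u x * v y)); last first.
    by move=> x _; apply: eq_bigr => y _; rewrite tE !inE vW !orbT mul1r.
  rewrite sum_offdiag mul1r addrAC subrr add0r normrN.
  apply: le_trans D _; rewrite ler_wpM2r // mulrDl.
  have : 0 <= c * r by rewrite mulr_ge0 // (le_trans _ r_ge1).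
  by have := r_ge1; lra.
(* The gap between 1 and [(1 + s) / 2]: what the apex adds in the row and column of [v0]. *)
pose d x y := 2^-1 * (1 - s (x |: (y |: W))).
have d1 x y : `|d x y| <= 1.
  have := s_le1 (x |: (y |: W)); rewrite /d !ler_norml => /andP[? ?]; lra.
have d1' x y : `|d y x| <= 1 by [].
pose star (e : 'I_n -> 'I_n -> R) (u v : 'I_n -> R) :=
  \sum_(x | x \notin W) \sum_(y | (y \notin W) && (y != x))
      (if x == v0 then e x y else 0) * (u x * v y).
have st1 := star_bound W u v v0 d1; have st2 := star_bound W v u v0 d1'.
(* Off the two stars at [v0], [t] is [1/2 + s/2]; the constant part gives half the all-ones form up
   to its missing diagonal. *)
have -> : link_form t W u v -
   2^-1 * ((\sum_(x | x \notin W) u x) * (\sum_(x | x \notin W) v x)) =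
   2^-1 * link_form s W u v - 2^-1 * \sum_(x | x \notin W) u x * v x +
   star d u v + star (fun x y => d y x) v u.
  have -> : star (fun x y => d y x) v u =
    \sum_(x | x \notin W) \sum_(y | (y \notin W) && (y != x))
      (if y == v0 then d x y else 0) * (u x * v y).
    rewrite /star (exchange_big_dep [pred x | x \notin W]) /=; last by move=> x y _ /andP[].
    apply: eq_bigr => x xW; apply: eq_big => y; first by rewrite xW /= eq_sym.
    by move=> _; rewrite [v y * _]mulrC.
  have := sum_offdiag W u v; set A := (X in X = _); set B := \sum_(x | _) u x * v x.
  move=> eA; have -> : (\sum_(x | x \notin W) u x) * (\sum_(x | x \notin W) v x) = A + B.
    by rewrite eA subrK.
  set T := (X in _ = _ + X); have -> : link_form t W u v =
      2^-1 * link_form s W u v + 2^-1 * A + (star d u v + T); last by ring.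
  rewrite /link_form /A /star /T !mulr_sumr -!big_split /=.
  apply: eq_bigr => x xW; rewrite !mulr_sumr -!big_split /=.
  apply: eq_bigr => y /andP[yW yx].
  rewrite tE !inE (negPf vW) orbF ![v0 == _]eq_sym /d.
  by move: yx; case: (eqVneq x v0) => [->|_]; case: (eqVneq y v0) => //= *; field.
have h1 := hs u v; have h2 := hs v u; rewrite [sq_norm W v + _]addrC in h2.
rewrite [sq_norm W v + _]addrC in st2.
rewrite -/S in h1 h2 st1 st2; rewrite -/(star d u v) in st1.
rewrite -/(star (fun x y => d y x) v u) in st2.
rewrite link_form_upper; move: D h1 h2 st1 st2.
rewrite !ler_norml => /andP[? ?] /andP[? ?] /andP[? ?] /andP[? ?] /andP[? ?].
have Sr : S <= r * S by rewrite ler_peMl.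
have cS : (c + 2) * r * S = c * r * S + 2 * (r * S) by ring.
rewrite cS.
by apply/andP; split; lra.
Qed.

Lemma link_error_scale W u v (a b : R) :
  link_error v0 t W (fun x => a * u x) (fun x => b * v x) =
  a * b * link_error v0 t W u v.
Proof.
rewrite /link_error /link_form -!mulr_sumr mulrBr; congr (_ - _); last by ring.
rewrite mulr_sumr; apply: eq_bigr => x _; rewrite mulr_sumr.
by apply: eq_bigr => y _; ring.
Qed.

(** By bilinearity, scaling [u] by the root of [tau] and [v] by its inverse leaves the error
    unchanged and weights the symmetric bound. *)
Lemma link_error_bound W u v (tau : R) : 0 < tau ->
  (forall u v, `|upper_form W u v| <= c * r * (sq_norm W u + sq_norm W v)) ->
  `|link_error v0 t W u v| <=
    (c + 2) * r * (tau * sq_norm W u + tau^-1 * sq_norm W v).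
Proof.
move=> tau0 hs; pose a := Num.sqrt tau.
have a0 : 0 < a by rewrite sqrtr_gt0.
have a2 : a ^+ 2 = tau by rewrite sqr_sqrtr // ltW.
have := link_error_sym (fun x => a * u x) (fun x => a^-1 * v x) hs.
rewrite link_error_scale mulfV ?gt_eqF // mul1r.
have sc W' u' b : sq_norm W' (fun x => b * u' x) = b ^+ 2 * sq_norm W' u'.
  by rewrite /sq_norm mulr_sumr; apply: eq_bigr => x _; rewrite exprMn.
by rewrite !sc exprVn a2.
Qed.

End LinkError.

(** * Operator norms through a net of integer vectors *)

Section Net.
Variables (R : realType) (n : nat).
Implicit Types u v : 'I_n -> R.

Definition sumsq u : R := \sum_x u x ^+ 2.

Lemma sumsq_ge0 u : 0 <= sumsq u.
Proof. by apply: sumr_ge0 => x _; rewrite sqr_ge0. Qed.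

Definition net_type := {ffun 'I_n -> 'I_(16 * n).+1 * bool}.

(** The integer points of the ball of radius [4 * sqrt n], stored as absolute values and signs.
    Rounding costs at most [sqrt n] in norm, a quarter of the radius. *)
Definition net : {set net_type} := [set z : net_type | (\sum_i (z i).1 ^ 2 <= 16 * n)%N].

Definition net_vec (z : net_type) : 'I_n -> R :=
  fun i => (-1) ^+ (z i).2 * (z i).1%:R.

Lemma net_vec_sumsq z : z \in net -> sumsq (net_vec z) <= (16 * n)%:R.
Proof.
rewrite inE -(ler_nat R) natr_sum; apply: le_trans; apply: ler_sum => x _.
by rewrite /net_vec exprMn sqrr_sign mul1r natrX.
Qed.

(** Truncate towards zero: absolute values do not grow, so the ball is preserved, and each
    coordinate moves by less than one. *)
Lemma net_round u : sumsq u <= (16 * n)%:R ->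
  exists2 z, z \in net & sumsq (fun x => u x - net_vec z x) <= n%:R.
Proof.
move=> hu; have tr x : ((Num.truncn `|u x|)%:R <= `|u x| < (Num.truncn `|u x|).+1%:R)%R.
  by apply: truncn_itv.
have tsq : (\sum_x (Num.truncn `|u x|) ^ 2 <= 16 * n)%N.
  rewrite -(ler_nat R) natr_sum; apply: le_trans hu; apply: ler_sum => x _.
  rewrite natrX -[u x ^+ 2]real_normK ?num_real // lerXn2r ?nnegrE //.
  by have /andP[] := tr x.
have tb x : (Num.truncn `|u x| < (16 * n).+1)%N.
  rewrite ltnS; apply: leq_trans tsq; rewrite (bigD1 x) //=.
  by apply: leq_trans (leq_addr _ _); case: (Num.truncn _) => // m; rewrite leq_pmulr.
pose z : net_type := [ffun x => (Ordinal (tb x), u x < 0)].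
exists z; first by rewrite inE; under eq_bigr do rewrite ffunE.
apply: (@le_trans _ _ (\sum_(x < n) 1)); last by rewrite sumr_const card_ord.
apply: ler_sum => x _; rewrite /net_vec ffunE /=.
move: (tr x); case: (ltrP (u x) 0) => h.
  rewrite (ltr0_norm h) -natr1; move: (Num.truncn _)%:R => t /andP[h1 h2].
  by rewrite expr1; nra.
rewrite (ger0_norm h) -natr1; move: (Num.truncn _)%:R => t /andP[h1 h2].
by rewrite expr0; nra.
Qed.

Lemma sum_half_pow m : \sum_(i < m) (2^-1 : R) ^+ i <= 2.
Proof.
have -> : \sum_(i < m) (2^-1 : R) ^+ i = 2 - 2 * 2^-1 ^+ m.
  elim: m => [|m IH]; first by rewrite big_ord0 expr0; ring.
  by rewrite big_ord_recr /= IH exprS; field.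
by rewrite lerBlDr lerDl mulr_ge0 // exprn_ge0 // invr_ge0.
Qed.

(* Markov's inequality for the weight [2^-|z|^2]. *)
Lemma net_card : (#|net|%:R : R) <= 2 ^+ (18 * n).
Proof.
pose wt (p : 'I_(16 * n).+1 * bool) : R := 2^-1 ^+ (p.1 ^ 2).
have wt0 p : 0 <= wt p by rewrite exprn_ge0 // invr_ge0.
(* Each of the two signs contributes at most a geometric sum of 2. The product over coordinates is
   thus at most [4 ^ n], to be multiplied by [2 ^ (16 n)]. *)
have wsum : \sum_p wt p <= 4.
  rewrite -(pair_bigA _ (fun i b => wt (i, b))) /=.
  rewrite (eq_bigr (fun i : 'I_(16 * n).+1 => 2 * 2^-1 ^+ (i ^ 2))); last first.
    by move=> i _; rewrite big_bool /wt /=; ring.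
  rewrite -mulr_sumr; apply: (@le_trans _ _ (2 * 2)); last by rewrite -natrM.
  rewrite ler_pM2l //.
  apply: le_trans (sum_half_pow (16 * n).+1); apply: ler_sum => i _.
  rewrite ler_wiXn2l ?invr_ge0 ?invf_le1 ?ler1n //.
  by case: (nat_of_ord i) => // m; rewrite leq_pmulr.
have : (#|net|%:R : R) * 2^-1 ^+ (16 * n) <= \sum_(z : net_type) \prod_i wt (z i).
  rewrite [leRHS](bigID [in net]) /= -sumr_const mulr_suml -[leLHS]addr0 lerD //.
    apply: ler_sum => z; rewrite inE mul1r => hz; rewrite prodrXr.
    by rewrite ler_wiXn2l ?invr_ge0 ?invf_le1 ?ler1n.
  by apply: sumr_ge0 => z _; apply: prodr_ge0.
rewrite -(bigA_distr_bigA (fun (i : 'I_n) p => wt p)) prodr_const card_ord.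
rewrite exprVn ler_pdivrMr ?exprn_gt0 // => /le_trans; apply.
rewrite (_ : (18 * n = 2 * n + 16 * n)%N); last by lia.
rewrite exprD ler_pM2r ?exprn_gt0 // exprM.
rewrite lerXn2r ?nnegrE ?sumr_ge0 ?exprn_ge0 //.
by apply: le_trans wsum _; rewrite expr2 -natrM.
Qed.

Variable M : 'I_n -> 'I_n -> R.

Definition bilin u v : R := \sum_x \sum_y M x y * (u x * v y).

Lemma bilinDl u u' v : bilin (fun x => u x + u' x) v = bilin u v + bilin u' v.
Proof.
rewrite /bilin -big_split; apply: eq_bigr => x _; rewrite -big_split.
by apply: eq_bigr => y _ /=; ring.
Qed.

Lemma bilinDr u v v' : bilin u (fun x => v x + v' x) = bilin u v + bilin u v'.
Proof.
rewrite /bilin -big_split; apply: eq_bigr => x _; rewrite -big_split.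
by apply: eq_bigr => y _ /=; ring.
Qed.

Lemma bilinZ a b u v : bilin (fun x => a * u x) (fun x => b * v x) = a * b * bilin u v.
Proof.
rewrite /bilin mulr_sumr; apply: eq_bigr => x _; rewrite mulr_sumr.
by apply: eq_bigr => y _ /=; ring.
Qed.

Lemma eq_bilin u u' v v' : u =1 u' -> v =1 v' -> bilin u v = bilin u' v'.
Proof.
by move=> uu vv; apply: eq_bigr => x _; apply: eq_bigr => y _; rewrite uu vv.
Qed.

Lemma sumsqZ a u : sumsq (fun x => a * u x) = a ^+ 2 * sumsq u.
Proof. by rewrite /sumsq mulr_sumr; apply: eq_bigr => x _; rewrite exprMn. Qed.

Lemma bilin_trivial : exists2 m : R, 0 <= m &
  forall u v, sumsq u <= (16 * n)%:R -> sumsq v <= (16 * n)%:R -> bilin u v <= m.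
Proof.
exists (\sum_x \sum_y `|M x y| * (16 * n)%:R).
  by apply: sumr_ge0 => x _; apply: sumr_ge0 => y _; rewrite mulr_ge0.
move=> u v hu hv; apply: ler_sum => x _; apply: ler_sum => y _.
apply: le_trans (ler_norm _) _; rewrite normrM ler_wpM2l //.
have e (w : 'I_n -> R) i : w i ^+ 2 <= sumsq w.
  by rewrite /sumsq (bigD1 i) //= lerDl sumr_ge0 // => j _; rewrite sqr_ge0.
have := le_trans (e u x) hu; have := le_trans (e v y) hv; rewrite ler_norml.
have := sqr_ge0 (u x - v y); have := sqr_ge0 (u x + v y).
move: (u x) (v y) => a b; nra.
Qed.

(* Rounding both arguments to the net costs half of the trivial bound, hence
   iterating brings any bound down to [2 * b]. *)
Lemma bilin_net_iter (b m : R) j : 0 <= m ->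
  (forall u v, sumsq u <= (16 * n)%:R -> sumsq v <= (16 * n)%:R -> bilin u v <= m) ->
  (forall z w, z \in net -> w \in net -> bilin (net_vec z) (net_vec w) <= b) ->
  forall u v, sumsq u <= (16 * n)%:R -> sumsq v <= (16 * n)%:R ->
    bilin u v <= 2 * b + m / 2 ^+ j.
Proof.
move=> m0 hm hb; elim: j => [|j IH] u v hu hv.
  rewrite expr0 divr1 (le_trans (hm _ _ hu hv)) // lerDr mulr_ge0 //.
  have z0 : sumsq (fun=> 0) <= (16 * n)%:R.
    by rewrite /sumsq big1 // => x _; rewrite expr0n.
  have [z zn _] := net_round z0; pose z' : net_type := [ffun x => (ord0, false)].
  have zn' : z' \in net by rewrite inE big1 // => i _; rewrite ffunE.
  have := hb z' z zn' zn; rewrite /bilin big1 // => x _; apply: big1 => y _.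
  by rewrite /net_vec ffunE /= mulr0 mul0r mulr0.
have [z zn uz] := net_round hu; have [w wn vw] := net_round hv.
(* Multiplied by 4, a rounding error is back in the ball, so each of the two error terms is at most
   a quarter of the inductive bound: [b + (2 * b + q) / 2 = 2 * b + q / 2]. *)
have quarter (a : 'I_n -> R) : sumsq a <= n%:R -> sumsq (fun x => 4 * a x) <= (16 * n)%:R.
  by move=> ha; rewrite sumsqZ -natrX natrM ler_wpM2l.
pose du x := u x - net_vec z x; pose dv x := v x - net_vec w x.
have -> : bilin u v = bilin (net_vec z) (net_vec w) + bilin du (net_vec w) + bilin u dv.
  rewrite -bilinDl -(@eq_bilin u _ (net_vec w) _ _ (fun=> erefl)); last first.
    by move=> x; rewrite /du addrC subrK.
  by rewrite -bilinDr; apply: eq_bilin => // x; rewrite /dv addrC subrK.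
have h1 := IH _ _ (quarter _ uz) (net_vec_sumsq wn).
have h2 := IH _ _ hu (quarter _ vw).
have h3 := hb z w zn wn.
have e1 : bilin (fun x => 4 * du x) (net_vec w) = 4 * bilin du (net_vec w).
  rewrite -[RHS]mul1r mulrA [1 * 4]mulrC -bilinZ.
  by apply: eq_bilin => // x; rewrite mul1r.
have e2 : bilin u (fun x => 4 * dv x) = 4 * bilin u dv.
  rewrite -[4 in RHS]mul1r -bilinZ.
  by apply: eq_bilin => // x; rewrite mul1r.
rewrite -/du e1 in h1; rewrite -/dv e2 in h2.
rewrite exprS invfM; move: h1 h2 h3; set q := m / 2 ^+ j.
have -> : m * (2^-1 / 2 ^+ j) = q / 2 by rewrite /q; field; rewrite expf_neq0 // pnatr_eq0.
by lra.
Qed.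

Lemma bilin_net (b : R) : (0 < n)%N ->
  (forall z w, z \in net -> w \in net -> bilin (net_vec z) (net_vec w) <= b) ->
  forall u v, `|bilin u v| <= b / (8 * n%:R) * (sumsq u + sumsq v).
Proof.
move=> n0 hb; have [m m0 hm] := bilin_trivial.
have ball u v : sumsq u <= (16 * n)%:R -> sumsq v <= (16 * n)%:R -> bilin u v <= 2 * b.
  (* A gap [e] above [2 * b] is refuted by some [j] with [m / 2 ^+ j < e]. *)
  move=> hu hv; rewrite leNgt; apply/negP => lt; set e := bilin u v - 2 * b.
  have e0 : 0 < e by rewrite subr_gt0.
  have := archi_boundP (divr_ge0 m0 (ltW e0)); set j := Num.bound _ => hj.
  have := bilin_net_iter j m0 hm hb hu hv; apply/negP; rewrite -ltNge.
  rewrite -ltrBrDl -/e ltr_pdivrMr ?exprn_gt0 // mulrC -ltr_pdivrMr //.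
  by apply: lt_trans hj _; rewrite -natrX ltr_nat ltn_expl.
have nR : 0 < n%:R :> R by rewrite ltr0n.
have half u v : bilin u v <= b / (8 * n%:R) * (sumsq u + sumsq v).
  have [S0|S0] := eqVneq (sumsq u + sumsq v) 0.
    rewrite S0 mulr0 /bilin big1 // => x _; apply: big1 => y _.
    have su : sumsq u = 0 by have := sumsq_ge0 u; have := sumsq_ge0 v; lra.
    move/eqP: su; rewrite psumr_eq0 => [/allP/(_ x)|i _]; last exact: sqr_ge0.
    by rewrite mem_index_enum sqrf_eq0 => /(_ isT)/eqP ->; rewrite mul0r mulr0.
  set S := sumsq u + sumsq v in S0 *.
  have Sp : 0 < S by rewrite lt_def S0 addr_ge0 ?sumsq_ge0.
  have q0 : 0 <= (16 * n)%:R / S by rewrite divr_ge0 // ltW.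
  pose a := Num.sqrt ((16 * n)%:R / S).
  have a2 : a ^+ 2 = (16 * n)%:R / S by rewrite sqr_sqrtr.
  have sc w : sumsq w <= S -> sumsq (fun x => a * w x) <= (16 * n)%:R.
    by move=> wS; rewrite sumsqZ a2 mulrAC ler_pdivrMr // ler_wpM2l.
  have hu : sumsq u <= S by rewrite lerDl sumsq_ge0.
  have hv : sumsq v <= S by rewrite lerDr sumsq_ge0.
  have := ball _ _ (sc _ hu) (sc _ hv); rewrite bilinZ -expr2 a2.
  rewrite mulrAC ler_pdivrMr // natrM mulrC -ler_pdivlMr ?mulr_gt0 //.
  move=> /le_trans; apply; rewrite le_eqVlt; apply/orP; left; apply/eqP.
  by field; rewrite gt_eqF.
move=> u v; rewrite ler_norml half andbT lerNl.
have -> : - bilin u v = bilin (fun x => -1 * u x) (fun x => 1 * v x).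
  by rewrite bilinZ mulr1 mulN1r.
by apply: le_trans (half _ _) _; rewrite !sumsqZ sqrrN expr1n !mul1r.
Qed.

End Net.

(** * Hoeffding's inequality by counting sign vectors *)

Section Hoeffding.
Local Notation exp := Rtrigo_def.exp.

Lemma expD (x y : R) : exp (x + y) = exp x * exp y.
Proof. exact: (esym (expRD x y)). Qed.

Lemma expR_gt0 (x : R) : 0 < exp x.
Proof. by apply/RltP; exact: exp_pos. Qed.

Lemma expR_ge1Dx (x : R) : 1 + x <= exp x.
Proof. by apply/RleP; exact: exp_ineq1_le. Qed.

Lemma expR_mulN (x : R) : exp x * exp (- x) = 1.
Proof. by rewrite -expD subrr expR0. Qed.

Lemma ler_exp (x y : R) : x <= y -> exp x <= exp y.
Proof.
move=> xy; rewrite -(subrK x y) addrC expD ler_peMr // ?(ltW (expR_gt0 _)) //.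
by apply: le_trans (expR_ge1Dx _); rewrite lerDl subr_ge0.
Qed.

(** The constant 2 in the exponent, instead of the optimal 1/2, lets [1 + x <= exp x] suffice: it
    gives [exp x <= 1 / (1 - x)] when [|x| <= 1/2], and beyond that already [|x| <= 2 * x ^+ 2]. *)
Lemma exp_sym_le (x : R) : exp x + exp (- x) <= 2 * exp (2 * x ^+ 2).
Proof.
case: (lerP (4 * x ^+ 2) 1) => hx.
  have h1 := expR_ge1Dx x; have h2 := expR_ge1Dx (- x); have h3 := expR_mulN x.
  have h4 := expR_ge1Dx (2 * x ^+ 2); have p1 := expR_gt0 x; have p2 := expR_gt0 (- x).
  have x1 : x < 1 by nra.
  have x2 : - 1 < x by nra.
  have aux (p q d : R) : 0 < p -> 0 < d -> d <= q -> p * q = 1 -> p <= d^-1.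
    by move=> p0 d0 dq pq; rewrite -[leRHS]mul1r ler_pdivlMr // -pq ler_pM2l.
  have e1 : exp x <= (1 - x)^-1 by apply: aux h2 h3 => //; rewrite subr_gt0.
  have e2 : exp (- x) <= (1 + x)^-1.
    by apply: aux h1 _ => //; [lra | rewrite mulrC].
  apply: le_trans (lerD e1 e2) _.
  apply: (@le_trans _ _ (2 * (1 + 2 * x ^+ 2))); last by rewrite ler_pM2l.
  have -> : (1 - x)^-1 + (1 + x)^-1 = 2 / (1 - x ^+ 2).
    by field; rewrite !gt_eqF //; nra.
  by rewrite ler_pdivrMr; nra.
have h (y : R) : y ^+ 2 = x ^+ 2 -> exp y <= exp (2 * x ^+ 2).
  by move=> yx; apply: ler_exp; rewrite -yx; nra.
by rewrite mulrC mulr_natr mulr2n lerD ?h ?sqrrN.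
Qed.

Definition sg (b : bool) : R := (-1) ^+ b.

Lemma exp_sum (I : finType) (P : pred I) (f : I -> R) :
  exp (\sum_(i | P i) f i) = \prod_(i | P i) exp (f i).
Proof.
by apply: (big_morph exp); [exact: expD | exact: expR0].
Qed.

Lemma mgf_le (T : finType) (c : T -> R) :
  \sum_(a : {ffun T -> bool}) exp (\sum_t c t * sg (a t)) <=
  2 ^+ #|T| * exp (2 * \sum_t c t ^+ 2).
Proof.
under eq_bigr => a _ do rewrite exp_sum.
rewrite -(bigA_distr_bigA (fun t b => exp (c t * sg b))) mulr_sumr exp_sum.
rewrite -prodr_const -big_split /=; apply: ler_prod => t _.
rewrite big_bool /sg /= expr1 expr0 mulr1 mulrN1 addrC exp_sym_le andbT.
by rewrite addr_ge0 // ltW // expR_gt0.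
Qed.

Lemma hoeffding (T : finType) (c : T -> R) (V b : R) : 0 < V -> 0 <= b ->
  \sum_t c t ^+ 2 <= V ->
  #|[set a : {ffun T -> bool} | b < \sum_t c t * sg (a t)]|%:R <=
  2 ^+ #|T| * exp (- (b ^+ 2 / (8 * V))).
Proof.
(* [l] minimises [2 * l ^+ 2 * V - l * b], with value [- b ^+ 2 / (8 * V)]. *)
move=> V0 b0 cV; set A := [set a | _]; pose l := b / (4 * V).
have l0 : 0 <= l by rewrite divr_ge0 // mulr_ge0 // ltW.
have h : #|A|%:R * exp (l * b) <= 2 ^+ #|T| * exp (2 * (l ^+ 2 * V)).
  apply: le_trans (_ : \sum_(a : {ffun T -> bool})
     exp (\sum_t (l * c t) * sg (a t)) <= _); last first.
    apply: le_trans (mgf_le _) _; rewrite ler_wpM2l ?exprn_ge0 //.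
    apply: ler_exp; rewrite ler_wpM2l //.
    under eq_bigr => t _ do rewrite exprMn.
    by rewrite -mulr_sumr ler_wpM2l // sqr_ge0.
  rewrite [leRHS](bigID [in A]) /= -sumr_const mulr_suml -[leLHS]addr0 lerD //.
    apply: ler_sum => a; rewrite inE mul1r => ha; apply: ler_exp.
    under eq_bigr => t _ do rewrite -mulrA.
    by rewrite -mulr_sumr ler_wpM2l // ltW.
  by apply: sumr_ge0 => a _; rewrite ltW // expR_gt0.
rewrite -(ler_pM2r (expR_gt0 (l * b))) -[leRHS]mulrA -expD.
apply: le_trans h _; rewrite ler_wpM2l ?exprn_ge0 // ler_exp //.
rewrite le_eqVlt /l; apply/orP; left; apply/eqP; field.
by rewrite gt_eqF.
Qed.

(** Points of [T] outside the image of [h] receive coefficient 0. *)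
Lemma hoeffding_inj (J T : finType) (P : pred J) (h : J -> T) (c : J -> R) (V b : R) :
  {in P &, injective h} -> 0 < V -> 0 <= b -> \sum_(j | P j) c j ^+ 2 <= V ->
  #|[set a : {ffun T -> bool} | b < \sum_(j | P j) c j * sg (a (h j))]|%:R <=
  2 ^+ #|T| * exp (- (b ^+ 2 / (8 * V))).
Proof.
move=> hinj V0 b0 cV; pose c' t := \sum_(j | P j && (h j == t)) c j.
have := @hoeffding T c' V b V0 b0; set A := [set a | _] => H; set B := [set a | _].
have -> : B = A.
  apply/setP => a; rewrite !inE; congr (_ < _); rewrite (partition_big h xpredT) //=.
  apply: eq_bigr => t _; rewrite mulr_suml; apply: eq_bigr => j /andP[_ /eqP <-] //.
apply: H; apply: le_trans cV; rewrite [leRHS](partition_big h xpredT) //=.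
apply: ler_sum => t _; rewrite /c'.
case: (pickP [pred j | P j && (h j == t)]) => [j /= /andP[Pj /eqP hj]|h0]; last first.
  by rewrite !big_pred0 // expr0n.
have e i : P i && (h i == t) = (i == j).
  apply/andP/eqP => [[Pi /eqP hi]|->]; last by rewrite Pj hj.
  by apply: hinj => //; rewrite hi hj.
by rewrite !(eq_bigl _ _ e) !big_pred1_eq.
Qed.

End Hoeffding.

(** * Independence of coboundary values at a vertex *)

Section RandomCoboundary.
Variable n : nat.
Implicit Types (F G H W : {set 'I_n}) (w : 'I_n).
Local Notation omega := {ffun {set 'I_n} -> bool}.
Local Notation exp := Rtrigo_def.exp.

Definition cobb (a : {set 'I_n} -> bool) H : bool :=
  \big[addb/false]_(G | facet G H) a G.

(** A triangular change of variables: by [cobb_cone] the value at [F] is shifted by values on sets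
    through [w], which are kept; hence an involution. *)
Definition twist w (a : omega) : omega :=
  [ffun F : {set 'I_n} => if w \in F then a F else cobb a (w |: F)].

Lemma cobb_cone (a : {set 'I_n} -> bool) w F : w \notin F ->
  cobb a (w |: F) = a F (+) \big[addb/false]_(u in F) a (w |: F :\ u).
Proof.
move=> wF; rewrite /cobb big_facets big_setU1 //= setU1K //; congr (_ (+) _).
apply: eq_bigr => u uF; congr (a _); apply/setP => x; rewrite !inE.
by case: (eqVneq x w) => [->|//]; rewrite orTb andbT; apply: contraNneq wF => ->.
Qed.

Lemma twistK w : involutive (twist w).
Proof.
move=> a; apply/ffunP => F; rewrite [LHS]ffunE; case: ifP => [wF|/negbT wF].
  by rewrite ffunE wF.
rewrite cobb_cone // ffunE (negPf wF) cobb_cone //.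
rewrite [X in _ (+) _ (+) X](eq_bigr (fun u => a (w |: F :\ u))).
  by rewrite -addbA addbb addbF.
by move=> u _; rewrite ffunE setU11.
Qed.

(* For a fixed vertex [w] the values of the coboundary on the sets through [w]
   are independent and uniform: [twist w] preserves the uniform measure. *)
Lemma hoeffding_cob (J : finType) (P : pred J) (h : J -> {set 'I_n}) w
    (c : J -> R) (V b : R) :
  {in P, forall j, w \notin h j} -> {in P &, injective h} ->
  0 < V -> 0 <= b -> \sum_(j | P j) c j ^+ 2 <= V ->
  #|[set a : omega | b < \sum_(j | P j) c j * sg (cobb a (w |: h j))]|%:R <=
  2 ^+ #|{set 'I_n}| * exp (- (b ^+ 2 / (8 * V))).
Proof.
move=> hw hinj V0 b0 cV; apply: le_trans (hoeffding_inj hinj V0 b0 cV).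
rewrite ler_nat -(card_imset _ (can_inj (twistK w))) subset_leq_card //.
apply/subsetP => _ /imsetP[a + ->]; rewrite !inE.
congr (_ < _); apply: eq_bigr => j Pj; congr (_ * sg _).
by rewrite ffunE (negPf (hw j Pj)).
Qed.

End RandomCoboundary.

(** * Bad events and the union bound *)

Section Existence.
Local Notation exp := Rtrigo_def.exp.

Lemma card_bigcup_le (R : realDomainType) (I T : finType) (P : pred I) (E : I -> {set T}) (b : R) :
  (forall i, P i -> #|E i|%:R <= b) -> #|\bigcup_(i | P i) E i|%:R <= #|P|%:R * b.
Proof.
move=> hE; apply: (@le_trans _ _ (\sum_(i | P i) #|E i|%:R)); last first.
  by rewrite mulr_natl -sumr_const; apply: ler_sum.
rewrite -natr_sum ler_nat.
apply: (big_rec2 (fun (A : {set T}) m => #|A| <= m)%N) => [|i m A _ IH].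
  by rewrite cards0.
by apply: leq_trans (leq_card_setU _ _).1 _; rewrite leq_add2l.
Qed.

Lemma expN_nat_le m : exp (- m%:R) <= 2^-1 ^+ m.
Proof.
have e1 : exp (- 1) <= 2^-1.
  have := expR_ge1Dx 1; have := expR_mulN 1; have := expR_gt0 (- 1).
  by move: (exp 1) (exp (- 1)) => p q; nra.
elim: m => [|m IH]; first by rewrite oppr0 expR0 expr0.
rewrite -natr1 opprD expD exprSr; apply: ler_pM => //; exact/ltW/expR_gt0.
Qed.

Lemma bin_le_exp n k : ('C(n, k) <= n ^ k)%N.
Proof.
elim: k => [|k IH]; first by rewrite bin0.
have h : ('C(n, k.+1) <= k.+1 * 'C(n, k.+1))%N by rewrite leq_pmull.
apply: leq_trans h _; rewrite mul_bin_left expnS.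
by apply: leq_mul => //; exact: leq_subr.
Qed.

Lemma expX (x : R) m : exp (m%:R * x) = exp x ^+ m.
Proof.
elim: m => [|m IH]; first by rewrite mul0r expR0.
by rewrite -natr1 mulrDl mul1r expD IH exprSr.
Qed.

(** Raise [exp q >= q], for [q = n / (128 (k + 1))], to the power [k + 1]. *)
Lemma poly_exp_small (k n : nat) : (4 * (128 * k.+1) ^ k.+1 <= n)%N ->
  (n ^ k)%:R * exp (- (n%:R / 128)) <= 4^-1.
Proof.
move=> hn; pose q : R := n%:R / (128 * k.+1)%:R.
have K0 : 0 < (128 * k.+1)%:R :> R by rewrite ltr0n.
have q0 : 0 <= q by rewrite divr_ge0.
have e : n%:R / 128 = k.+1%:R * q :> R.
  have k0 : k.+1%:R != 0 :> R by rewrite pnatr_eq0.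
  rewrite /q natrM; move: k.+1%:R k0 => c c0; by field.
have h : q ^+ k.+1 <= exp (n%:R / 128).
  rewrite e expX lerXn2r ?nnegrE ?(ltW (expR_gt0 _)) //.
  by apply: le_trans (expR_ge1Dx _); rewrite lerDr.
have h2 : 4 * (n ^ k)%:R <= q ^+ k.+1.
  rewrite /q exprMn exprVn ler_pdivlMr ?exprn_gt0 // -!natrX -!natrM ler_nat.
  by rewrite mulnAC [leqRHS]expnS leq_mul2r hn orbT.
have := le_trans h2 h; rewrite -(ler_pM2r (expR_gt0 (- (n%:R / 128)))) expR_mulN.
by rewrite -mulrA; lra.
Qed.

Variable n : nat.
Local Notation omega := {ffun {set 'I_n} -> bool}.
Local Notation K := (@card_sets n).
Implicit Types (F W : {set 'I_n}) (a : omega).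

Definition sgc (a : {set 'I_n} -> bool) (H : {set 'I_n}) : R := sg (cobb a H).

Definition upper_pairs W : pred ('I_n * 'I_n) :=
  [pred p | [&& p.1 \notin W, p.2 \notin W & (p.1 < p.2)%N]].

(** The squared coefficients sum to at most [(16 n)^2], so this threshold has failure probability at
    most [2 ^ (- 128 n)], against at most [2 ^ (37 n)] triples [(W, z, w)]. *)
Definition upper_bad W (r : R) (z w : net_type n) : {set omega} :=
  [set a : omega | 512 * n%:R * r < \sum_(p | upper_pairs W p)
      (net_vec R z p.1 * net_vec R w p.2) * sgc a (p.1 |: (p.2 |: W))].

Lemma upper_bad_card W (r : R) z w : (0 < n)%N -> 0 <= r -> r ^+ 2 = n%:R ->
  W != set0 -> z \in net n -> w \in net n ->
  (#|upper_bad W r z w|%:R : R) <= 2 ^+ #|{set 'I_n}| * 2^-1 ^+ (128 * n).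
Proof.
move=> n0 r0 r2 /set0Pn[w0 w0W] zn wn.
(* All sets in the sum contain [w0], so their signs are independent; deleting [w0] gives the
   indexing of [hoeffding_cob]. *)
pose h (p : 'I_n * 'I_n) := p.1 |: (p.2 |: (W :\ w0)).
have nR : 0 < n%:R :> R by rewrite ltr0n.
have hE p : p.1 |: (p.2 |: W) = w0 |: h p.
  by rewrite /h [RHS]setUCA [w0 |: (p.2 |: _)]setUCA setD1K.
have hw : {in upper_pairs W, forall p, w0 \notin h p}.
  move=> [x y] /and3P[/= xW yW _]; rewrite !inE !negb_or eqxx /= andbT.
  by apply/andP; split; [apply: contraNneq xW | apply: contraNneq yW] => <-.
have hinj : {in upper_pairs W &, injective h}.
  move=> [x y] [x' y'] /and3P[/= xW yW xy] /and3P[/= xW' yW' xy'] e.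
  have mem u : u \notin W -> (u \in h (x, y)) = (u == x) || (u == y).
    by move=> uW; rewrite !inE (negPf uW) andbF orbF.
  have mem' u : u \notin W -> (u \in h (x', y')) = (u == x') || (u == y').
    by move=> uW; rewrite !inE (negPf uW) andbF orbF.
  have := mem' x xW; rewrite -e mem // eqxx /= => /esym/orP xx.
  have := mem' y yW; rewrite -e mem // eqxx orbT => /esym/orP yy.
  case: xx => /eqP xx; case: yy => /eqP yy; subst => //.
  - by rewrite ltnn in xy.
  - by move: (ltn_trans xy xy'); rewrite ltnn.
  - by rewrite ltnn in xy.
have V0 : 0 < (256 * n%:R ^+ 2 : R) by rewrite mulr_gt0 // exprn_gt0.
have b0 : 0 <= 512 * n%:R * r by rewrite !mulr_ge0.
have cV : \sum_(p | upper_pairs W p) (net_vec R z p.1 * net_vec R w p.2) ^+ 2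
    <= 256 * n%:R ^+ 2.
  apply: (@le_trans _ _ (\sum_p (net_vec R z p.1 * net_vec R w p.2) ^+ 2)).
    rewrite [leRHS](bigID (upper_pairs W)) /= lerDl.
    by apply: sumr_ge0 => p _; exact: sqr_ge0.
  rewrite -(pair_bigA _ (fun x y => (net_vec R z x * net_vec R w y) ^+ 2)) /=.
  apply: (@le_trans _ _ (sumsq (net_vec R z) * sumsq (net_vec R w))).
    rewrite /sumsq mulr_suml; apply: ler_sum => x _; rewrite mulr_sumr.
    by apply: ler_sum => y _; rewrite exprMn.
  have -> : 256 * n%:R ^+ 2 = (16 * n)%:R * (16 * n)%:R :> R by rewrite natrM; ring.
  by apply: ler_pM; rewrite ?sumsq_ge0 ?net_vec_sumsq.
have := hoeffding_cob hw hinj V0 b0 cV.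
have -> : (512 * n%:R * r) ^+ 2 / (8 * (256 * n%:R ^+ 2)) = (128 * n)%:R.
  by rewrite !exprMn r2 natrM; field; rewrite gt_eqF.
move=> h1; apply: le_trans (_ : _ <= 2 ^+ #|{set 'I_n}| * exp (- (128 * n)%:R)) _.
  apply: le_trans h1; rewrite ler_nat subset_leq_card //; apply/subsetP => a.
  rewrite !inE => /lt_le_trans; apply; rewrite le_eqVlt; apply/orP; left; apply/eqP.
  by apply: eq_bigr => p _; rewrite hE.
by rewrite ler_wpM2l ?exprn_ge0 // expN_nat_le.
Qed.

(** A deviation of order [n] is exponentially unlikely, while only polynomially many [F] occur. The
    coefficients are [- 1] because [hoeffding_cob] bounds upper tails. *)
Definition deg_bad F : {set omega} :=
  [set a : omega | n%:R / 4 < \sum_(y | y \notin F) (- 1) * sgc a (y |: F)].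

Lemma deg_bad_card F : (0 < n)%N -> F != set0 ->
  (#|deg_bad F|%:R : R) <= 2 ^+ #|{set 'I_n}| * exp (- (n%:R / 128)).
Proof.
move=> n0 /set0Pn[w0 w0F]; pose h (y : 'I_n) := y |: (F :\ w0).
have nR : 0 < n%:R :> R by rewrite ltr0n.
have hE y : y |: F = w0 |: h y by rewrite /h [RHS]setUCA setD1K.
have hw : {in [pred y | y \notin F], forall y, w0 \notin h y}.
  move=> y /= yF; rewrite !inE eqxx /= orbF.
  by apply: contraNneq yF => <-.
have hinj : {in [pred y | y \notin F] &, injective h}.
  move=> x y /= xF yF e; have : x \in h y by rewrite -e setU11.
  by rewrite !inE (negPf xF) andbF orbF => /eqP.
have b0 : 0 <= n%:R / 4 :> R by rewrite divr_ge0.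
have cV : \sum_(y | y \notin F) (-1) ^+ 2 <= n%:R :> R.
  under eq_bigr do rewrite sqrrN expr1n.
  by rewrite sumr_const ler_nat (leq_trans (max_card _)) // card_ord.
have := hoeffding_cob hw hinj nR b0 cV.
have -> : (n%:R / 4) ^+ 2 / (8 * n%:R) = n%:R / 128 :> R.
  by field; rewrite gt_eqF.
apply: le_trans; rewrite ler_nat subset_leq_card //; apply/subsetP => a.
rewrite !inE => /lt_le_trans; apply; rewrite le_eqVlt; apply/orP; left; apply/eqP.
by apply: eq_bigr => p _; rewrite hE.
Qed.

Variable k : nat.
Local Notation NM := ('C(n, k) * 'C(n, k.-1))%N.

(** The sum is ['C(n, k)] minus twice the Hamming distance from [a] to the coboundary of [D]. The
    threshold yields the exponent [8 * 'C(n, k.-1)], enough for the [2 ^ 'C(n, k.-1)] choices of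
    [D]. *)
Definition near_bad (D : {set {set 'I_n}}) : {set omega} :=
  [set a : omega | 8 * Num.sqrt NM%:R <
     \sum_(F in K k) sg (a F (+) cobb (fun G => G \in D) F)].

Lemma card_card_sets s : #|K s| = 'C(n, s).
Proof. by rewrite card_draws card_ord. Qed.

Lemma near_bad_card D : (k <= n)%N ->
  (#|near_bad D|%:R : R) <= 2 ^+ #|{set 'I_n}| * 2^-1 ^+ (8 * 'C(n, k.-1)).
Proof.
move=> kn; have N0 : 0 < 'C(n, k)%:R :> R by rewrite ltr0n bin_gt0.
(* Adding a fixed coboundary permutes the cochains, so the bound for the plain sum of signs carries
   over. *)
pose sh (a : omega) : omega := [ffun F => a F (+) cobb (fun G => G \in D) F].
have shK : involutive sh by move=> a; apply/ffunP => F; rewrite !ffunE -addbA addbb addbF.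
have b0 : 0 <= 8 * Num.sqrt NM%:R :> R by rewrite mulr_ge0 // sqrtr_ge0.
have cV : \sum_(F in K k) (1 : R) ^+ 2 <= 'C(n, k)%:R.
  by under eq_bigr do rewrite expr1n; rewrite sumr_const card_card_sets.
have := @hoeffding_inj _ _ [in K k] id (fun=> 1) _ _ (in2W (fun x y => id)) N0 b0 cV.
have -> : (8 * Num.sqrt NM%:R) ^+ 2 / (8 * 'C(n, k)%:R) = (8 * 'C(n, k.-1))%:R :> R.
  by rewrite exprMn sqr_sqrtr // !natrM; field; rewrite gt_eqF.
move=> h1; apply: le_trans (_ : _ <= 2 ^+ #|{set 'I_n}| * exp (- (8 * 'C(n, k.-1))%:R)) _.
  apply: le_trans h1; rewrite ler_nat -(card_imset _ (can_inj shK)) subset_leq_card //.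
  apply/subsetP => _ /imsetP[a + ->]; rewrite !inE.
  move=> /lt_le_trans; apply; rewrite le_eqVlt; apply/orP; left; apply/eqP.
  by apply: eq_bigr => F _; rewrite ffunE mul1r.
by rewrite ler_wpM2l ?exprn_ge0 // expN_nat_le.
Qed.

Lemma exists_good_cochain (r : R) : 0 <= r -> r ^+ 2 = n%:R -> (1 < k)%N -> (k <= n)%N ->
  (4 * (128 * k.+1) ^ k.+1 <= n)%N ->
  exists a : omega,
  [/\ forall W u v, W \in K k.-1 -> `|upper_form (sgc a) W u v| <=
        64 * r * (sq_norm W u + sq_norm W v),
      forall F, F \in K k -> - (n%:R / 4) <= \sum_(y | y \notin F) sgc a (y |: F) &
      forall g : {set 'I_n} -> bool,
        \sum_(F in K k) sg (a F (+) cobb g F) <= 8 * Num.sqrt NM%:R].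
Proof.
move=> r0 r2 k1 kn hn; have n0 : (0 < n)%N by apply: leq_trans kn; apply: leq_trans k1.
set T := #|{set 'I_n}|; pose T2 : R := 2 ^+ T.
have T0 : 0 < T2 by rewrite exprn_gt0.
have half1 m : (2^-1 : R) ^+ m <= 1.
  by apply: exprn_ile1; lra.
pose I1 := [pred q : {set 'I_n} * (net_type n * net_type n) |
   [&& q.1 != set0, q.2.1 \in net n & q.2.2 \in net n]].
pose B1 := \bigcup_(q | I1 q) upper_bad q.1 r q.2.1 q.2.2.
pose B2 := \bigcup_(F in K k) deg_bad F.
pose B3 := \bigcup_(D in powerset (K k.-1)) near_bad D.
have c1 : (#|B1|%:R : R) <= T2 * 4^-1.
  apply: le_trans (card_bigcup_le (b := T2 * 2^-1 ^+ (128 * n)) _) _.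
    by move=> [W [z w]] /and3P[/= *]; apply: upper_bad_card.
  rewrite mulrCA ler_pM2l //.
  (* [2 ^ n] sets [W], and twice at most [2 ^ (18 n)] net points. *)
  have cI : #|I1|%:R <= 2 ^+ (37 * n) :> R.
    apply: (@le_trans _ _ (#|{set 'I_n}| * (#|net n| * #|net n|))%:R).
      rewrite ler_nat -cardsT -!cardsX subset_leq_card //.
      by apply/subsetP => -[W [z w]] /and3P[/= _ zn wn]; rewrite !in_setX in_setT zn wn.
    rewrite natrM -[#|{set 'I_n}|]cardsT -powersetT card_powerset cardsT card_ord natrX natrM.
    rewrite (_ : (37 * n = n + (18 * n + 18 * n))%N); last by lia.
    rewrite (exprD 2 n) (exprD 2 (18 * n)%N) ler_pM2l ?exprn_gt0 //.
    by apply: ler_pM; rewrite ?ler0n ?(net_card R n).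
  rewrite (_ : (128 * n = 37 * n + (2 + (91 * n - 2)))%N); last by lia.
  rewrite exprD mulrA; apply: (@le_trans _ _ (1 * (2^-1 ^+ (2 + (91 * n - 2))))).
    rewrite ler_wpM2r ?exprn_ge0 ?invr_ge0 // exprVn ler_pdivrMr ?exprn_gt0 //.
    by rewrite mul1r.
  rewrite mul1r exprD expr2 (_ : 2^-1 * 2^-1 = 4^-1 :> R); last by field.
  by rewrite ler_piMr ?half1 // invr_ge0.
have c2 : (#|B2|%:R : R) <= T2 * 4^-1.
  apply: le_trans (card_bigcup_le (b := T2 * exp (- (n%:R / 128))) _) _.
    move=> F; rewrite inE => cF; apply: deg_bad_card => //.
    by rewrite -card_gt0 (eqP cF) (leq_trans _ k1).
  rewrite mulrCA ler_pM2l //; apply: le_trans (poly_exp_small hn).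
  rewrite ler_wpM2r ?(ltW (expR_gt0 _)) // ler_nat.
  by apply: leq_trans (bin_le_exp n k); rewrite -card_card_sets.
have c3 : (#|B3|%:R : R) <= T2 * 4^-1.
  apply: le_trans (card_bigcup_le (b := T2 * 2^-1 ^+ (8 * 'C(n, k.-1))) _) _.
    by move=> D _; apply: near_bad_card.
  rewrite mulrCA ler_pM2l //.
  have -> : #|[in powerset (K k.-1)]| = (2 ^ 'C(n, k.-1))%N.
    by rewrite -card_card_sets -card_powerset; apply: eq_card.
  have M0 : (0 < 'C(n, k.-1))%N by rewrite bin_gt0 (leq_trans _ kn) // leq_pred.
  move: ('C(n, k.-1)) M0 => M M0; rewrite natrX.
  rewrite (_ : (8 * M = M + (2 + (7 * M - 2)))%N); last by lia.
  rewrite exprD mulrA exprVn mulfV ?expf_neq0 ?pnatr_eq0 // mul1r.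
  rewrite exprD expr2 (_ : 2^-1 * 2^-1 = 4^-1 :> R); last by field.
  by rewrite ler_piMr ?half1 // invr_ge0.
have : exists a, a \notin B1 :|: B2 :|: B3.
  apply/existsP; rewrite -negb_forall; apply/negP => /forallP all.
  have : (T2 <= #|B1 :|: B2 :|: B3|%:R).
    rewrite /T2 -natrX ler_nat /T -[2%N]card_bool -card_ffun -cardsT.
    by apply: subset_leq_card; apply/subsetP => a _; apply: all.
  have : (#|B1 :|: B2 :|: B3|%:R <= #|B1|%:R + #|B2|%:R + #|B3|%:R :> R).
    rewrite -!natrD ler_nat; apply: leq_trans (leq_card_setU _ _).1 _.
    by rewrite leq_add2r; exact: (leq_card_setU _ _).1.
  by lra.
case=> a; rewrite !inE !negb_or -andbA => /and3P[/bigcupP nB1 /bigcupP nB2 /bigcupP nB3].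
exists a; split.
- move=> W u v WK.
  have W0 : W != set0.
    by move: WK; rewrite inE -card_gt0 => /eqP ->; rewrite -ltnS prednK // ltnW.
  pose M (x y : 'I_n) := if [&& x \notin W, y \notin W & (x < y)%N] then
     sgc a (x |: (y |: W)) else 0.
  have uM (u' v' : 'I_n -> R) : upper_form (sgc a) W u' v' = bilin M u' v'.
    rewrite /upper_form /bilin big_mkcond; apply: eq_bigr => x _; rewrite big_mkcond.
    case: (boolP (x \notin W)) => xW.
      apply: eq_bigr => y _; rewrite /M xW /=.
      by case: (_ && _); rewrite ?mul0r.
    by rewrite big1 // => y _; rewrite /M (negPf xW) mul0r.
  have hb z w : z \in net n -> w \in net n ->
      bilin M (net_vec R z) (net_vec R w) <= 512 * n%:R * r.
    move=> zn wn; rewrite leNgt; apply/negP => lt; apply: nB1.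
    exists (W, (z, w)); first by rewrite /I1 /= W0 zn wn.
    rewrite inE; apply: lt_le_trans lt _; rewrite le_eqVlt; apply/orP; left; apply/eqP.
    rewrite /bilin pair_bigA /= [RHS]big_mkcond; apply: eq_bigr => -[x y] _ /=.
    by rewrite /M /upper_pairs /=; case: ifP => _; [exact: mulrC | exact: mul0r].
  (* [bilin] runs over all vertices; cutting [u] and [v] off on [W] changes neither the form nor
     [sq_norm]. *)
  pose u' x := if x \notin W then u x else 0; pose v' x := if x \notin W then v x else 0.
  have -> : upper_form (sgc a) W u v = upper_form (sgc a) W u' v'.
    apply: eq_bigr => x xW; apply: eq_bigr => y /andP[yW _].
    by rewrite /u' /v' xW yW.
  have sq (f : 'I_n -> R) : sq_norm W f = sumsq (fun x => if x \notin W then f x else 0).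
    rewrite /sq_norm /sumsq big_mkcond; apply: eq_bigr => x _.
    by case: ifP; rewrite // expr0n.
  rewrite uM !sq; apply: le_trans (bilin_net n0 hb _ _) _.
  rewrite (_ : 512 * n%:R * r / (8 * n%:R) = 64 * r) //.
  by field; rewrite pnatr_eq0 -lt0n.
- move=> F FK; rewrite leNgt; apply/negP => lt; apply: nB2.
  exists F => //; rewrite inE -mulr_sumr mulN1r ltrNr //.
- move=> g; rewrite leNgt; apply/negP => lt; apply: nB3.
  exists [set G in K k.-1 | g G]; first by rewrite inE; apply/subsetP => G; rewrite inE => /andP[].
  rewrite inE; apply: lt_le_trans lt _; rewrite le_eqVlt; apply/orP; left; apply/eqP.
  apply: eq_bigr => F; rewrite inE => /eqP cF; congr (sg (_ (+) _)).
  apply: eq_bigr => G /facet_card; rewrite cF => cG.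
  by rewrite !inE; rewrite cG eqxx.
Qed.

End Existence.

(** * The cone complex: faces, spectrum, norms, homology *)

Section ConeComplex.
Variables (n k : nat) (v0 : 'I_n) (a : {set 'I_n} -> bool).
Hypotheses (k_gt1 : (1 < k)%N) (kn : (k < n)%N).
Implicit Types (F G H W : {set 'I_n}).
Local Notation K := (@card_sets n).

Let k_gt0 : (0 < k)%N. Proof. exact: ltnW. Qed.

Definition cone_complex : {set {set 'I_n}} :=
  [set H : {set 'I_n} | (#|H| <= k)%N ||
     ((#|H| == k.+1) && ((v0 \in H) || ~~ cobb a H))].

Local Notation Y := cone_complex.

Lemma cone_complex_is_complex : is_complex Y.
Proof.
move=> F G; rewrite !inE => hF sGF; have cGF := subset_leq_card sGF.
case/orP: hF => [hF|/andP[/eqP cF hF]]; first by rewrite (leq_trans cGF hF).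
case: (ltngtP #|G| k.+1) => [|lt|cG]; first by rewrite ltnS => ->.
  by move: (leq_trans lt cGF); rewrite cF ltnn.
have /eqP-> : G == F by rewrite eqEcard sGF cF cG /=.
by rewrite hF orbT.
Qed.

Lemma cone_complex_skel : complete_skel Y k.
Proof. by move=> F hF; rewrite inE hF. Qed.

Lemma cone_mem H : v0 \in H -> (#|H| <= k.+1)%N -> H \in Y.
Proof. by move=> vH; rewrite inE vH andbT orbC leq_eqVlt. Qed.

(** A smaller face grows by [v0], or by any outside vertex if it contains [v0] already. *)
Lemma cone_complex_pure : pure_dim Y k.
Proof.
move=> F FY max; apply/eqP; move: FY; rewrite inE => /orP[hF|/andP[]//].
have grow x : x \notin F -> v0 \in x |: F -> #|F| == k.+1.
  move=> xF vF; have := max (x |: F) (cone_mem vF _) (subsetUr _ _).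
  rewrite cardsU1 xF ltnS hF => /(_ isT) e; have := setU11 x F.
  by rewrite e (negPf xF).
case: (boolP (v0 \in F)) => vF; last by apply: (grow v0) => //; rewrite setU11.
have : (0 < #|[pred x | x \notin F]|)%N by rewrite card_notin subn_gt0 (leq_ltn_trans hF).
by case/card_gt0P => x xF; apply: (grow x) => //; rewrite in_setU1 vF orbT.
Qed.

Lemma cone_faces s : (s <= k)%N -> faces Y s = K s.
Proof.
move=> sk; apply/setP => F; rewrite !inE; case: (eqVneq #|F| s) => [->|]; rewrite ?andbF //.
by rewrite sk.
Qed.

Lemma cone_faces_top H : (H \in faces Y k.+1) =
  (#|H| == k.+1) && ((v0 \in H) || ~~ cobb a H).
Proof.
rewrite !inE; case: eqP => [->|]; rewrite ?andbF //.
by rewrite ltnn andbT.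
Qed.

Lemma cob2_cobb s (g : {set 'I_n} -> bool) H : (s <= k)%N -> #|H| = s.+1 ->
  cob2 Y s g H = cobb g H.
Proof.
move=> sk cH; apply: eq_bigl => G; rewrite cone_faces // inE.
case: (boolP (facet G H)) => [/facet_card|]; rewrite ?andbF // cH => -[->].
by rewrite eqxx.
Qed.

(** Membership written affinely in the sign, to be compared with 1/2; it is the indicator on
    [(k+1)]-sets only. *)
Definition cone_ind (H : {set 'I_n}) : R :=
  if v0 \in H then 1 else 2^-1 * (1 + sgc a H).
Local Notation t := cone_ind.

Lemma cone_indE H : #|H| = k.+1 -> t H = (H \in Y)%:R.
Proof.
move=> cH; rewrite /t inE cH ltnn eqxx /= /sgc /sg; case: (v0 \in H) => //=.
by case: (cobb a H) => /=; rewrite ?expr1 ?expr0; lra.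
Qed.

Lemma incRE F G : incR F G = inc R F G.
Proof. by rewrite /incR /inc RpowE. Qed.

Lemma AupE F G : F \in K k -> G \in K k -> Aup Y k F G = up_coef k t F G.
Proof.
rewrite !inE => /eqP cF /eqP cG; rewrite /Aup /up_coef; case: eqP => //= cFG.
rewrite !incRE cone_indE; last by rewrite cardsU cF cG cFG; lia.
by case: ifP => _; rewrite ?mulr1 ?mulr0.
Qed.

Lemma degE F : F \in K k -> INR (deg Y k F) = up_deg t F.
Proof.
rewrite inE => /eqP cF; rewrite INRE /up_deg -(big_cofacets _ F t) /=.
rewrite (eq_bigr (fun H => (H \in Y)%:R)); last first.
  by move=> H /facet_card; rewrite cF => cH; rewrite cone_indE.
rewrite /deg -natr_sum -sum1_card; congr (_%:R); rewrite [RHS]big_mkcond [LHS]big_mkcond.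
apply: eq_bigr => H _; rewrite !inE.
case: (eqVneq #|H| k.+1) => cH.
  by rewrite facetE ?cF //; case: (F \subset H); rewrite ?andbF ?andbT //; case: ifP.
rewrite andbF /=; case: ifP => // /facet_card; rewrite cF => e.
by rewrite e eqxx in cH.
Qed.

Lemma cobRE (g : {set 'I_n} -> R) F : F \in K k -> cobR Y k.-1 g F = cob g F.
Proof.
rewrite inE => /eqP cF; rewrite /cobR /rsum cone_faces ?leq_pred // /cob cF.
by apply: eq_bigr => W _; rewrite incRE.
Qed.

Lemma sg_le1 b : `|sg b| <= 1.
Proof. by rewrite /sg normr_sign. Qed.

(** Each term is at least [(1 + s) / 2], and [((n - k) - n / 4) / 2 >= n / 4] once [k <= n / 4]. *)
Lemma up_deg_ge F : (4 * k <= n)%N -> F \in K k ->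
  - (n%:R / 4) <= \sum_(y | y \notin F) sgc a (y |: F) -> n%:R / 4 <= up_deg t F.
Proof.
move=> k4 FK hs.
have : \sum_(y | y \notin F) 2^-1 * (1 + sgc a (y |: F)) <= up_deg t F.
  apply: ler_sum => y _; rewrite /t; case: ifP => // _.
  by have := sg_le1 (cobb a (y |: F)); rewrite -/(sgc a _) ler_norml => /andP[]; lra.
rewrite -mulr_sumr big_split /= sumr_const card_notin; move: FK; rewrite inE => /eqP ->.
have : (4 * k)%:R <= n%:R :> R by rewrite ler_nat.
have -> : (n - k)%:R = n%:R - k%:R :> R by rewrite natrB // ltnW.
by rewrite natrM; move: hs; lra.
Qed.

(** The form at [f] is [1 - lam] times the weighted square norm, itself at least [n / 4] times the
    plain one. The constant is [1056 = 4 * 4 * 66], with [66 = 64 + 2] from [link_error_bound]. *)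
Lemma cone_eig (r lam : R) : (4 * k <= n)%N -> 1 <= r -> r ^+ 2 = n%:R ->
  (forall W u v, W \in K k.-1 -> `|upper_form (sgc a) W u v| <=
        64 * r * (sq_norm W u + sq_norm W v)) ->
  (forall F, F \in K k -> - (n%:R / 4) <= \sum_(y | y \notin F) sgc a (y |: F)) ->
  nontrivial_eig Y k lam -> `|1 - lam| <= (1056 * k)%:R / r.
Proof.
move=> k4 r1 r2 hU hD [f [[F0 [F0Y f0]] [forth feig]]].
have r0 : 0 < r by apply: lt_le_trans r1.
have n0 : 0 < n%:R :> R by rewrite -r2 exprn_gt0.
rewrite cone_faces // in F0Y feig.
have Dn F (FK : F \in K k) := up_deg_ge k4 FK (hD F FK).
set N := \sum_(F in K k) f F ^+ 2.
have N0 : 0 < N.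
  rewrite /N (bigD1 F0) //= ltr_pwDl //; first by rewrite exprn_even_gt0 //=; apply/eqP.
  by apply: sumr_ge0 => F _; exact: sqr_ge0.
have bdD W : W \in K k.-1 -> bd k (fun F => up_deg t F * f F) W = 0.
  (* Orthogonality is tested on the coboundary of the indicator of [W]. *)
  move=> WK; have := forth (fun W' => (W' == W)%:R).
  rewrite /inner /rsum cone_faces // => h.
  have {}h : \sum_(F in K k) (up_deg t F * f F) * cob (fun W' => (W' == W)%:R) F = 0.
    by rewrite -[RHS]h; apply: eq_bigr => F FK; rewrite degE // cobRE.
  move: h; rewrite cob_bd_adjoint // (bigD1 W) //= eqxx mulr1 big1 ?addr0 //.
  by move=> W' /andP[_ /negPf ->]; rewrite mulr0.
have E0 : 0 < (64 + 2) * r by rewrite mulr_gt0 //; lra.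
have c0 : 0 <= 64 :> R by [].
have hb : `|up_form k t f f| <= 4 * ((64 + 2) * r) * k%:R * N.
  apply: (@up_form_bound _ n k v0) => // [H vH|W u v tau WK tau0].
    by rewrite /t vH.
  apply: (link_error_bound (s := sgc a)) => //.
    by move=> H; exact: sg_le1.
  by move=> u' v'; exact: hU.
have eqf : up_form k t f f = (1 - lam) * \sum_(F in K k) up_deg t F * f F ^+ 2.
  rewrite /up_form mulr_sumr; apply: eq_bigr => F FK.
  have D0 : 0 < up_deg t F by apply: lt_le_trans (Dn F FK); rewrite divr_gt0.
  have := feig F FK; rewrite /Lap_up degE // /rsum cone_faces // => e.
  have {}e : f F - (up_deg t F)^-1 * (\sum_(G in K k) up_coef k t F G * f G) = lam * f F.
    rewrite -[RHS]e; congr (_ - _ * _); apply: eq_bigr => G GK.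
    by rewrite AupE.
  have -> : \sum_(G in K k) up_coef k t F G * (f F * f G) =
      f F * \sum_(G in K k) up_coef k t F G * f G.
    by rewrite mulr_sumr; apply: eq_bigr => G _; ring.
  move: e; set S := \sum_(G in K k) _ => e.
  have -> : S = up_deg t F * (f F - lam * f F).
    by rewrite -e; field; rewrite gt_eqF.
  by ring.
have hN : n%:R / 4 * N <= \sum_(F in K k) up_deg t F * f F ^+ 2.
  by rewrite mulr_sumr; apply: ler_sum => F FK; rewrite ler_wpM2r ?sqr_ge0 // Dn.
rewrite eqf normrM [X in _ * X]ger0_norm in hb; last first.
  by apply: le_trans hN; rewrite mulr_ge0 // ?divr_ge0 // ltW.
have {}hb : `|1 - lam| * (n%:R / 4 * N) <= 4 * ((64 + 2) * r) * k%:R * N.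
  by apply: le_trans hb; rewrite ler_wpM2l.
have {}hb : `|1 - lam| * (n%:R / 4) <= 4 * ((64 + 2) * r) * k%:R.
  by rewrite -(ler_pM2r N0) -[leLHS]mulrA.
rewrite -r2 in hb.
rewrite ler_pdivlMr // -(ler_pM2r r0) natrM.
by move: hb; nra.
Qed.

(** Double counting: a top face has [k + 1] facets, a [k]-set has degree at least [n / 4]. *)
Lemma cone_top_card : (4 * k <= n)%N ->
  (forall F, F \in K k -> - (n%:R / 4) <= \sum_(y | y \notin F) sgc a (y |: F)) ->
  'C(n, k)%:R * (n%:R / 4) <= k.+1%:R * #|faces Y k.+1|%:R :> R.
Proof.
move=> k4 hD; have -> : k.+1%:R * #|faces Y k.+1|%:R = \sum_(F in K k) up_deg t F :> R.
  rewrite /up_deg (@sum_link _ n k.+1 _ (fun F H => t H)) //.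
  transitivity (\sum_(H in K k.+1) k.+1%:R * (H \in Y)%:R : R).
    rewrite -mulr_sumr -natr_sum; congr (_ * _%:R); rewrite -sum1_card.
    rewrite big_mkcond [RHS]big_mkcond; apply: eq_bigr => H _.
    by rewrite /faces !inE andbC; case: (_ == _); case: (_ || _).
  apply: eq_bigr => H; rewrite inE => /eqP cH.
  by rewrite (big_facets _ H (fun=> t H)) /= sumr_const cH cone_indE // mulr_natl.
rewrite -card_card_sets mulr_natl -sumr_const; apply: ler_sum => F FK.
exact: up_deg_ge (hD F FK).
Qed.

(** Deleting [v0] injects the top faces carrying the coboundary of [a] into the [k]-sets;
    [cone_top_card] bounds the denominator. *)
Lemma cone_norm2 : (4 * k <= n)%N ->
  (forall F, F \in K k -> - (n%:R / 4) <= \sum_(y | y \notin F) sgc a (y |: F)) ->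
  norm2 Y k.+1 (cob2 Y k a) <= (4 * k.+1)%:R / n%:R.
Proof.
move=> k4 hD; rewrite /norm2 !INRE RdivE.
have num : (#|[set F in faces Y k.+1 | cob2 Y k a F]| <= 'C(n, k))%N.
  rewrite -card_card_sets -(card_in_imset (f := fun H => H :\ v0)).
    apply: subset_leq_card; apply/subsetP => _ /imsetP[H + ->].
    rewrite inE cone_faces_top => /andP[/andP[/eqP cH hH] ch].
    rewrite cob2_cobb // in ch; rewrite ch orbF in hH.
    by rewrite inE -eqSS -cH (cardsD1 v0 H) hH.
  have vin H : H \in [set F in faces Y k.+1 | cob2 Y k a F] -> v0 \in H.
    rewrite inE cone_faces_top => /andP[/andP[/eqP cH hH] ch].
    by rewrite cob2_cobb // in ch; rewrite ch orbF in hH.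
  by move=> H H' /vin vH /vin vH' e; rewrite -(setD1K vH) -(setD1K vH') e.
have top := cone_top_card k4 hD.
have n0 : 0 < n%:R :> R by rewrite ltr0n (leq_ltn_trans _ kn).
have N0 : 0 < 'C(n, k)%:R :> R by rewrite ltr0n bin_gt0 ltnW.
have k0 : 0 < k.+1%:R :> R by rewrite ltr0n.
have T0 : 0 < #|faces Y k.+1|%:R :> R.
  by rewrite -(pmulr_rgt0 _ k0); apply: lt_le_trans top; rewrite mulr_gt0 // divr_gt0.
rewrite ler_pdivrMr //; apply: (@le_trans _ _ 'C(n, k)%:R); first by rewrite ler_nat.
rewrite mulrAC ler_pdivlMr // natrM; move: top.
move: 'C(n, k)%:R n%:R k.+1%:R (#|_|%:R : R) => N m c T.
by rewrite -mulrA; lra.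
Qed.

Lemma cone_class_norm2 (b eps : R) :
  (forall g : {set 'I_n} -> bool, \sum_(F in K k) sg (a F (+) cobb g F) <= b) ->
  0 <= b -> b <= 2 * eps * 'C(n, k)%:R -> 2^-1 - eps <= class_norm2 Y k a.
Proof.
move=> hb b0 be; rewrite /class_norm2 !INRE RdivE cone_faces // card_card_sets.
have N0 : 0 < 'C(n, k)%:R :> R by rewrite ltr0n bin_gt0 ltnW.
rewrite ler_pdivlMr //.
apply: (@le_trans _ _ (2^-1 * ('C(n, k)%:R - b))).
  by rewrite mulrBl mulrBr lerD2l; lra.
(* The minimum starts from the default ['C(n, k)], which must satisfy the bound too; this is where
   [0 <= b] enters. *)
apply: (big_ind (fun m : nat => 2^-1 * ('C(n, k)%:R - b) <= m%:R)).
- by lra.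
- by move=> x y hx hy; rewrite /minn; case: ifP.
move=> g _; have := hb g.
set A := [set F in K k | _].
have -> : \sum_(F in K k) sg (a F (+) cobb g F) = 'C(n, k)%:R - 2 * #|A|%:R.
  rewrite (eq_bigr (fun F => 1 - 2 * (a F (+) cobb g F)%:R)); last first.
    by move=> F _; rewrite /sg; case: (_ (+) _) => /=; rewrite ?expr1 ?expr0; ring.
  rewrite sumrB -mulr_sumr sumr_const card_card_sets; congr (_ - 2 * _).
  rewrite -natr_sum -sum1_card; congr (_%:R); rewrite [LHS]big_mkcond [RHS]big_mkcond.
  apply: eq_bigr => F _; rewrite !inE; case: (eqVneq #|F| k) => cF //=.
  by rewrite cob2_cobb ?leq_pred ?prednK // ?cF.
by lra.
Qed.

Lemma incZE F G : incZ F G = inc Z F G.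
Proof.
rewrite /incZ /inc; case: ifP => // _; elim: (incpos F G) => [|m IH] //.
by rewrite Nat2Z.inj_succ Z.pow_succ_r ?IH ?exprS //; apply: Nat2Z.is_nonneg.
Qed.

Lemma bdZE s (c : {set 'I_n} -> Z) W : #|W|.+1 = s -> faces Y s = K s ->
  bdZ Y s c W = \sum_(x | x \notin W) inc Z (x |: W) W * c (x |: W).
Proof.
move=> cW fY; rewrite -sum_inc_up -(bdE _ cW) /bdZ fY.
by apply: eq_bigr => F _; rewrite incZE.
Qed.

Lemma inc_cone_vertex (R : comNzRingType) W : val v0 = 0%N -> v0 \notin W ->
  inc R (v0 |: W) W = 1.
Proof.
move=> v00 vW; rewrite inc_setU1 // /pos.
rewrite (_ : [set _ in _ | _] = set0) ?cards0 //; apply/setP => u.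
by rewrite !inE v00 ltn0 andbF.
Qed.

(** [v0] is the least vertex, so its presence raises the position of every other vertex by one. *)
Lemma inc_cone (R : comNzRingType) W x : val v0 = 0%N -> v0 \notin W ->
  x \notin W -> x != v0 -> inc R (x |: (v0 |: W)) (v0 |: W) = - inc R (x |: W) W.
Proof.
move=> v00 vW xW xv; rewrite !inc_setU1 ?in_setU1 ?negb_or ?xv //.
rewrite pos_setU1 // (_ : (v0 < x)%N = true) ?exprS ?mulN1r //.
by rewrite [nat_of_ord v0]v00 lt0n -v00 (inj_eq val_inj).
Qed.

(* The cone operator with apex [v0] is a contracting homotopy. *)
Lemma cone_homology i : val v0 = 0%N -> (i <= k.-1)%N -> red_hom_vanishes Y i.
Proof.
move=> v00 ik c hc; have ik' : (i < k)%N by rewrite -(prednK k_gt0) ltnS.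
pose d F : Z := if v0 \in F then c (F :\ v0) else 0.
exists d => F; rewrite cone_faces // inE => /eqP cF.
have -> : bdZ Y i.+2 d F = \sum_(x | x \notin F) inc Z (x |: F) F * d (x |: F).
  transitivity (\sum_(H in faces Y i.+2) inc Z H F * d H).
    by apply: eq_bigr => H _; rewrite incZE.
  rewrite -sum_inc_up -(@bdE _ _ i.+2) ?cF // /bd [LHS]big_mkcond [RHS]big_mkcond.
  (* When [i + 2 = k + 1] not all sets are faces, but [d] is supported on sets through [v0], which
     all are. *)
  apply: eq_bigr => H _; case: (boolP (v0 \in H)) => vH; last first.
    by rewrite /d (negPf vH) mulr0; do 2 case: ifP => //.
  rewrite [in RHS]inE inE andbC; case: eqP => //= cH.
  by rewrite cone_mem // cH.
case: (boolP (v0 \in F)) => vF; last first.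
  rewrite (bigD1 v0) //= big1 ?addr0.
    by rewrite inc_cone_vertex // mul1r /d setU11 setU1K.
  move=> x /andP[xF xv]; rewrite /d in_setU1 (negPf vF) eq_sym (negPf xv) mulr0 //.
(* When [v0 \in F], the cycle condition at [F :\ v0] expresses [c F] through the other cofaces. *)
pose G := F :\ v0; have vG : v0 \notin G by rewrite setD11.
have eF : F = v0 |: G by rewrite setD1K.
have cG : #|G| = i by move: cF; rewrite eF cardsU1 vG => -[].
have GY : G \in faces Y i by rewrite cone_faces ?inE ?cG // ltnW.
have := hc G GY; rewrite (@bdZE i.+1) ?cG ?cone_faces // (bigD1 v0) //=.
rewrite inc_cone_vertex // mul1r -eF => /eqP; rewrite addr_eq0 => /eqP ->.
rewrite -sumrN; apply: eq_big => [x|x /andP[xG xv]].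
  by rewrite eF in_setU1 negb_or andbC.
rewrite eF inc_cone // mulNr /d in_setU1 setU11 orbT.
congr (- (_ * c _)); apply/setP => u; rewrite !inE.
case: (eqVneq u v0) => [->|_] /=; last by [].
by rewrite eq_sym (negPf xv).
Qed.

End ConeComplex.

(** * Choice of the family and asymptotics *)

Section Family.
Variable k : nat.
Hypothesis k_gt1 : (1 < k)%N.

(** The summands serve [poly_exp_small], [up_deg_ge] and [ln n >= 1] respectively. *)
Definition threshold : nat := (4 * (128 * k.+1) ^ k.+1 + 4 * k + 3)%N.

Definition good_cochain (n : nat) (a : {set 'I_n} -> bool) : Prop :=
  [/\ forall W u v, W \in card_sets n k.-1 -> `|upper_form (sgc a) W u v| <=
        64 * Num.sqrt n%:R * (sq_norm W u + sq_norm W v),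
      forall F, F \in card_sets n k ->
        - (n%:R / 4) <= \sum_(y | y \notin F) sgc a (y |: F) &
      forall g : {set 'I_n} -> bool,
        \sum_(F in card_sets n k) sg (a F (+) cobb g F) <=
        8 * Num.sqrt ('C(n, k) * 'C(n, k.-1))%:R].

(** The implication sits under the existential so that a cochain can be chosen for every [n], an
    arbitrary one below the threshold. *)
Lemma good_cochain_exists n : exists a : {set 'I_n} -> bool,
  (threshold <= n)%N -> good_cochain a.
Proof.
case: (leqP threshold n) => [hn|_]; last by exists xpredT.
have [a ha] : exists a : {ffun {set 'I_n} -> bool}, good_cochain a.
  by apply: exists_good_cochain; rewrite ?sqrtr_ge0 ?sqr_sqrtr ?ler0n //;
    move: hn; rewrite /threshold; lia.
by exists a.
Qed.

Definition cochain n : {set 'I_n} -> bool := sval (boolp.cid (good_cochain_exists n)).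

Lemma cochainP n : (threshold <= n)%N -> good_cochain (@cochain n).
Proof. exact: (svalP (boolp.cid (good_cochain_exists n))). Qed.

(** The apex [ord0] is the least vertex, as [inc_cone] requires; there is none for [n = 0]. *)
Definition family n : {set {set 'I_n}} :=
  match n return {set {set 'I_n}} with
  | 0 => set0
  | m.+1 => cone_complex k ord0 (@cochain m.+1)
  end.

Lemma family_eig n (lam : R) : (threshold <= n)%N ->
  nontrivial_eig (family n) k lam ->
  1 - (1056 * k)%:R / Num.sqrt n%:R <= lam <= 1 + (1056 * k)%:R / Num.sqrt n%:R.
Proof.
case: n => [|n] hn; first by move: hn; rewrite /threshold; lia.
have [hU hD _] := cochainP hn.
move=> eig; rewrite -ler_distlC; apply: cone_eig hU hD eig => //; rewrite ?sqr_sqrtr //.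
- by move: hn; rewrite /threshold; lia.
- by move: hn; rewrite /threshold; lia.
- by rewrite -[leLHS]sqrtr1 ler_sqrt // ler1n.
Qed.

Lemma family_norm2 n : (threshold <= n)%N ->
  norm2 (family n) k.+1 (cob2 (family n) k (@cochain n)) <= (1056 * k)%:R / n%:R.
Proof.
case: n => [|n] hn; first by move: hn; rewrite /threshold; lia.
have [_ hD _] := cochainP hn.
apply: le_trans (cone_norm2 _ _ _ hD) _ => //.
- by move: hn; rewrite /threshold; lia.
- by move: hn; rewrite /threshold; lia.
- by rewrite ler_pdivrMr ?ltr0n // divfK ?pnatr_eq0 // ler_nat; move: k_gt1; lia.
Qed.

Lemma family_class_norm (eps : R) : 0 < eps -> exists N, forall n, (N <= n)%N ->
  2^-1 - eps <= class_norm2 (family n) k (@cochain n).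
Proof.
move=> e0; pose m := Num.bound ((16 * k)%:R / eps ^+ 2).
exists (threshold + m + k)%N => -[|n] hn; first by move: hn; rewrite /threshold; lia.
have kn : (k < n.+1)%N by move: hn; rewrite /threshold; lia.
have [|_ _ hg] := @cochainP n.+1; first by lia.
apply: (cone_class_norm2 ord0 k_gt1 kn hg); first by rewrite mulr_ge0 // sqrtr_ge0.
set N := 'C(n.+1, k); set M := 'C(n.+1, k.-1).
have N0 : 0 < N%:R :> R by rewrite ltr0n bin_gt0 ltnW.
have M0 : 0 <= M%:R :> R by [].
have NM : (k * N = (n.+1 - k.-1) * M)%N.
  by rewrite /N -{1 2}(prednK (ltnW k_gt1)) mul_bin_left.
(* Equivalent to [8 * sqrt (N * M) <= 2 * eps * N]; it holds for large [n] because
   [M / N = k / (n + 1 - (k - 1))]. *)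
have h : 16 * M%:R <= eps ^+ 2 * N%:R.
  have k0 : 0 < k%:R :> R by rewrite ltr0n ltnW.
  rewrite -(ler_pM2l k0) [leRHS]mulrCA -[k%:R * N%:R]natrM NM natrM !mulrA.
  rewrite ler_wpM2r // mulrC -natrM.
  have e20 : 0 < eps ^+ 2 by rewrite exprn_gt0.
  rewrite -ler_pdivrMl // mulrC; apply: ltW; apply: lt_le_trans (archi_boundP _) _.
    by rewrite divr_ge0 // ltW.
  by rewrite ler_nat -/m; move: hn; lia.
have -> : 2 * eps * N%:R = 8 * (eps * N%:R / 4) by field.
rewrite ler_pM2l //.
have q0 : 0 <= eps * N%:R / 4 by rewrite divr_ge0 // mulr_ge0 // ltW.
rewrite -[leRHS](ger0_norm q0) -sqrtr_sqr.
by rewrite ler_sqrt ?sqr_ge0 // natrM; nra.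
Qed.

End Family.

Delimit Scope R_scope with R.
Local Close Scope ring_scope.
Local Open Scope R_scope.

Theorem theorem1p4 :
  forall k : nat, (2 <= k)%N ->
  exists C : R, (0 < C)%R /\
  exists (N0 : nat) (Y : forall n : nat, {set {set 'I_n}})
         (a : forall n : nat, {set 'I_n} -> bool),
    (forall n : nat, (N0 <= n)%N ->
       is_complex (Y n) /\ pure_dim (Y n) k /\ complete_skel (Y n) k /\
       (forall lam : R, nontrivial_eig (Y n) k lam ->
          (1 - C / sqrt (INR n) <= lam <= 1 + C / sqrt (INR n))%R) /\
       (norm2 (Y n) k.+1 (cob2 (Y n) k (a n)) <= C * ln (INR n) / INR n)%R /\
       (forall i : nat, (i <= k.-1)%N -> red_hom_vanishes (Y n) i)) /\
    (forall eps : R, (0 < eps)%R ->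
       exists N : nat, forall n : nat, (N <= n)%N ->
         (1 / 2 - eps <= class_norm2 (Y n) k (a n))%R).
Proof.
move=> k k1; exists (INR (1056 * k)); split.
  by apply: lt_0_INR; apply/ssrnat.ltP; move: k1; lia.
exists (threshold k), (family k1), (cochain k1); split; last first.
  move=> eps /RltP e0; have [N hN] := family_class_norm k1 e0.
  exists N => n /hN /RleP; apply: Rle_trans; right.
  by rewrite /Rdiv Rmult_1_l.
case=> [|n] hn; first by move: hn; rewrite /threshold; lia.
have kn : (k < n.+1)%N by move: hn; rewrite /threshold; lia.
split; first exact: cone_complex_is_complex.
split; first exact: cone_complex_pure.
split; first exact: cone_complex_skel.
have n0 : Rlt 0 (INR n.+1) by apply: lt_0_INR; apply/ssrnat.ltP.
split; [|split].
- move=> lam /(family_eig hn).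
  by rewrite -RsqrtE -!INRE -!RdivE => /andP[/RleP h1 /RleP h2].
- have /RleP := family_norm2 k1 hn; rewrite -!INRE -RdivE => /Rle_trans; apply.
  rewrite /Rdiv; apply: Rmult_le_compat_r; first exact/Rlt_le/Rinv_0_lt_compat.
  rewrite -{1}[INR (1056 * k)]Rmult_1_r; apply: Rmult_le_compat_l; first exact: pos_INR.
  (* The construction gives [C / n]; the factor [ln n] is at least 1 because the number of vertices
     exceeds 3, hence [e]. *)
  rewrite -(ln_exp (IZR 1)); apply/Rlt_le/ln_increasing; first exact: exp_pos.
  apply: (Rle_lt_trans _ _ _ exp_le_3); rewrite (_ : 3 = INR 3); last by rewrite INR_IZR_INZ.
  by apply: lt_INR; apply/ssrnat.ltP; move: hn; rewrite /threshold; lia.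
- by move=> i; exact: cone_homology.
Qed.
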